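(* Let $\alpha\ge3$, $\theta\in\left[\frac{1}{\alpha-1},\frac12\right]$, $\beta\ge0$, let $\delta_0>0$ and let $\delta:[t_0,+\infty)\to[\delta_0,+\infty)$ be continuously differentiable with $$\inf_{t\ge t_0}\frac{t\dot\delta(t)}{\delta(t)}>-\infty,\qquad \sup_{t\ge t_0}\frac{t\dot\delta(t)}{\delta(t)}\le\frac1\theta-2,\qquad \lim_{t\to+\infty}t^2\delta(t)=+\infty.$$ Let $(x(t),\lambda(t))$ be a global trajectory on $[t_0,+\infty)$ of the dynamical system $$\begin{cases}\ddot{x}(t)+\dfrac{\alpha}{t}\dot{x}(t)+\delta(t)\left(\nabla f(x(t))+A^\top\bigl(\lambda(t)+\theta t\dot{\lambda}(t)\bigr)+\beta A^\top(Ax(t)-b)\right)=0,\\ \ddot{\lambda}(t)+\dfrac{\alpha}{t}\dot{\lambda}(t)-\delta(t)\bigl(A(x(t)+\theta t\dot{x}(t))-b\bigr)=0.\end{cases}$$ Then there exists $(x^*,\lambda^* )\in\Omega$ such that $(x(t),\lambda(t))\to(x^*,\lambda^* )$ as $t\to+\infty$. Moreover, if $\alpha>3$, $\theta\in\left(\frac{1}{\alpha-1},\frac12\right)$ and $\sup_{t\ge t_0}\frac{t\dot\delta(t)}{\delta(t)}<\frac1\theta-2$, then, as $t\to+\infty$, $$\|(\dot x(t),\dot\lambda(t))\|=o\left(\frac1t\right),\quad \|Ax(t)-b\|=o\left(\frac1{t^2\delta(t)}\right),\quad |f(x(t))-f(x^* )|=o\left(\frac1{t^2\delta(t)}\right)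.$$
   Context: Standing setting: $f:\mathbb{R}^n\to\mathbb{R}$ is convex and continuously differentiable ($\nabla f$ is not assumed Lipschitz), $A\in\mathbb{R}^{m\times n}$, $b\in\mathbb{R}^m$, $t_0>0$. The set of primal optimal solutions $\mathcal{S}=\operatorname{argmin}\{f(x): Ax=b\}$ is assumed nonempty. The primal-dual solution set is $\Omega=\{(x^*,\lambda^* )\in\mathbb{R}^n\times\mathbb{R}^m: Ax^*=b,\ \nabla f(x^* )+A^\top\lambda^*=0\}$, which is then nonempty. A global trajectory is a (twice differentiable) solution $(x,\lambda):[t_0,+\infty)\to\mathbb{R}^n\times\mathbb{R}^m$ of the system. *)

(* Defs.v *)
From HB Require Import structures.
From mathcomp Require Import all_boot all_order all_algebra.
From mathcomp Require Import all_classical all_reals all_analysis.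

Set Implicit Arguments.
Unset Strict Implicit.
Unset Printing Implicit Defensive.

Import Order.TTheory GRing.Theory Num.Theory.
Import numFieldNormedType.Exports.

Local Open Scope classical_set_scope.
Local Open Scope ring_scope.

(* The norm `|v| on matrices is the sup norm, hence a separate Euclidean one. *)
Definition enorm (R : realType) (n : nat) (v : 'cV[R]_n) : R :=
  Num.sqrt (\sum_(i < n) v i ord0 ^+ 2).

Definition grad (R : realType) (n : nat) (f : 'cV[R]_n -> R)
    (x : 'cV[R]_n) : 'cV[R]_n :=
  \col_(i < n) 'D_(delta_mx i ord0) f x.

Definition continuously_differentiable (R : realType) (n : nat)
    (f : 'cV[R]_n -> R) : Prop :=
  (forall x, differentiable f x) /\ continuous (grad f).

(* Derivative relative to a set D of times: on D = [t0, +oo[ it is the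
   ordinary derivative at t > t0 and the right derivative at t0, so values
   outside D play no role. *)
Section derivative_within.
Variables (R : realType) (V : normedModType R) (D : set R).

Definition diff_quotient (g : R -> V) (t s : R) : V :=
  (s - t)^-1 *: (g s - g t).

Definition derivable_within (g : R -> V) (t : R) : Prop :=
  cvg (diff_quotient g t s @[s --> within D t^']).

Definition derive_within (g : R -> V) (t : R) : V :=
  lim (diff_quotient g t s @[s --> within D t^']).

Definition differentiable_on (g : R -> V) : Prop :=
  forall t, D t -> derivable_within g t.

Definition C1_on (g : R -> V) : Prop :=
  differentiable_on g /\ {within D, continuous (derive_within g)}.

Definition twice_differentiable_on (g : R -> V) : Prop :=
  differentiable_on g /\ differentiable_on (derive_within g).

End derivative_within.

Section primal_dual.
Variables (R : realType) (n m : nat).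
Variables (f : 'cV[R]_n -> R) (A : 'M[R]_(m, n)) (b : 'cV[R]_m).

Definition primal_solutions : set 'cV[R]_n :=
  [set x | A *m x = b /\ forall y, A *m y = b -> f x <= f y].

Definition primal_dual_solutions : set ('cV[R]_n * 'cV[R]_m) :=
  [set z | A *m z.1 = b /\ grad f z.1 + A^T *m z.2 = 0].

Definition global_trajectory (t0 alpha theta beta : R) (delta : R -> R)
    (x : R -> 'cV[R]_n) (lam : R -> 'cV[R]_m) : Prop :=
  let D := `[t0, +oo[%classic in
  let x' := derive_within D x in
  let x'' := derive_within D x' in
  let lam' := derive_within D lam in
  let lam'' := derive_within D lam' in
  [/\ twice_differentiable_on D x,
      twice_differentiable_on D lam,
      forall t, D t ->
        x'' t + (alpha / t) *: x' t
        + delta t *: (grad f (x t) + A^T *m (lam t + (theta * t) *: lam' t)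
                      + beta *: (A^T *m (A *m x t - b))) = 0
    & forall t, D t ->
        lam'' t + (alpha / t) *: lam' t
        - delta t *: (A *m (x t + (theta * t) *: x' t) - b) = 0].

End primal_dual.

(* The values of t * delta'(t) / delta(t) for t >= t0, in \bar R since their
   infimum and supremum may be infinite. *)
Definition log_slopes (R : realType) (t0 : R) (delta : R -> R) : set (\bar R) :=
  [set (t * derive_within `[t0, +oo[%classic delta t / delta t)%:E | t in `[t0, +oo[%classic].

(* Lets the little-o notation be used at +oo. *)
Canonical pinfty_filter_on (R : realType) : filter_on R :=
  FilterType (pinfty_nbhs R) (@filter_filter _ _ proper_pinfty_nbhs).

(* Main.v *)
Require Import Defs.
From HB Require Import structures.
From mathcomp Require Import all_boot all_order all_algebra.
From mathcomp Require Import all_classical all_reals all_analysis.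
From mathcomp Require Import ring lra.

Set Implicit Arguments.
Unset Strict Implicit.
Unset Printing Implicit Defensive.

Import Order.TTheory GRing.Theory Num.Theory.
Import numFieldNormedType.Exports.

Local Open Scope classical_set_scope.
Local Open Scope ring_scope.

(** Write [z = (x, l)] for the trajectory and let [z* = (xs, ls)] be a saddle
    point, which exists because the gradient of [f] at a constrained minimizer
    is orthogonal to the kernel of [A] ([orthogonal_kernel]).

    Energy.  Let [xi = theta * (alpha - 1) - 1 >= 0] and let [gap] be the excess
    of the augmented Lagrangian at the multiplier [ls].  The function
      [E = theta^2 t^2 delta gap(x) + |z - z* + theta t z'|^2 / 2
           + xi |z - z*|^2 / 2]
    is nonincreasing: the two equations of the system are coupled through the
    extrapolated points [x + theta t x'] and [l + theta t l'], which is exactly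
    what makes the bilinear terms cancel in [E'], and what is left has a sign by
    convexity and by the upper bound on [t delta' / delta] ([energy_derive],
    [energy_derive_ub]).  Hence [z - z* + theta t z'] and [t^2 delta gap(x)] are
    bounded.

    Relaxation.  The asymptotics of single coordinates are read off from
    scalar equations [h' = a (r - h)] with [a >= 0]: bounds on [r] pass to
    [h], and so do limits when a primitive of [a] diverges
    ([relaxation_bounded], [relaxation_cvg]).  The equation
    [u + theta t u' = r] is of this form, so [z] and [t z'] are bounded as well.

    Cluster points.  By the multiplier equation, [r - theta t^2 delta (A x - b)]
    with [r = t l' + (alpha - 1) l] is relaxed towards the bounded function [r]
    ([residual_relaxation]).  So [t^2 delta (A x - b)] is bounded and, as
    [t^2 delta] diverges, [A x - b] and [gap(x)] tend to zero ([residual_cvg0],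
    [gap_cvg0]).  Every cluster point of [x] is then a minimizer of the
    Lagrangian, where the gradient of [f] is [- A^T ls]; by compactness
    [grad f (x t)] converges to this vector.  Reading the first equation as an
    equation of the form [u + theta t u' = r] for [A^T (l - ls)], up to a
    corrector, shows that [A^T l] converges to [A^T ls] ([dual_cvg]).  So all
    cluster points of [z] are saddle points, with the same [A^T l].

    Uniqueness.  For two such saddle points [z1] and [z2] the gaps coincide, so
    the difference of the two energies is, up to constants, [(1 + xi) H +
    theta t H'] with [H = <z, z2 - z1>].  It converges, hence so does [H], and
    evaluating the limit at both cluster points gives [|z2 - z1|^2 = 0]
    ([scalar_product_cvg], [trajectory_cvg]).  This also covers the
    critical case [xi = 0], in which the energy controls no integral of
    [t |z'|^2].

    Rates.  Take [z*] to be the limit.  Then [E] has the same limit as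
    [W = theta^2 (t^2 delta gap(x) + t^2 |z'|^2 / 2)].  When the inequalities
    between the parameters are strict, [E' <= - k W / t] for some [k > 0]; since
    [1 / t] has a divergent primitive, that limit must be zero.  In the
    relaxation of the residual the weight now diverges, so [r] and
    [r - theta t^2 delta (A x - b)] have the same limit. *)

(** * The Euclidean inner product *)

Section dot.
Variable R : realType.

Definition dot n (u v : 'cV[R]_n) : R := (u^T *m v) ord0 ord0.

Lemma dotE n (u v : 'cV[R]_n) : dot u v = \sum_i u i ord0 * v i ord0.
Proof. by rewrite /dot mxE; apply: eq_bigr => i _; rewrite mxE. Qed.

Lemma dotC n (u v : 'cV[R]_n) : dot u v = dot v u.
Proof. by rewrite !dotE; apply: eq_bigr => i _; rewrite mulrC. Qed.

Lemma dotDr n (u v w : 'cV[R]_n) : dot u (v + w) = dot u v + dot u w.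
Proof. by rewrite /dot mulmxDr mxE. Qed.

Lemma dotDl n (u v w : 'cV[R]_n) : dot (v + w) u = dot v u + dot w u.
Proof. by rewrite !(dotC _ u) dotDr. Qed.

Lemma dotNr n (u v : 'cV[R]_n) : dot u (- v) = - dot u v.
Proof. by rewrite /dot mulmxN mxE. Qed.

Lemma dotNl n (u v : 'cV[R]_n) : dot (- u) v = - dot u v.
Proof. by rewrite !(dotC _ v) dotNr. Qed.

Lemma dotZr n c (u v : 'cV[R]_n) : dot u (c *: v) = c * dot u v.
Proof. by rewrite /dot -scalemxAr mxE. Qed.

Lemma dotZl n c (u v : 'cV[R]_n) : dot (c *: u) v = c * dot u v.
Proof. by rewrite !(dotC _ v) dotZr. Qed.

Lemma dot0r n (u : 'cV[R]_n) : dot u 0 = 0.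
Proof. by rewrite /dot mulmx0 mxE. Qed.

Lemma dot0l n (u : 'cV[R]_n) : dot 0 u = 0.
Proof. by rewrite dotC dot0r. Qed.

Definition dotDE := (dotDl, dotDr, dotNl, dotNr, dotZl, dotZr).

Lemma dot_trmx n m (A : 'M[R]_(m, n)) u v : dot (A^T *m u) v = dot u (A *m v).
Proof. by rewrite /dot trmx_mul trmxK mulmxA. Qed.

Lemma dot_ge0 n (u : 'cV[R]_n) : 0 <= dot u u.
Proof. by rewrite dotE sumr_ge0// => i _; rewrite -expr2 sqr_ge0. Qed.

Lemma sqr_coord_le n (u : 'cV[R]_n) i : u i ord0 ^+ 2 <= dot u u.
Proof.
rewrite dotE (bigD1 i)//= expr2 lerDl sumr_ge0// => j _.
by rewrite -expr2 sqr_ge0.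
Qed.

Lemma dot_eq0 n (u : 'cV[R]_n) : dot u u = 0 -> u = 0.
Proof.
move=> u0; apply/matrixP => i j; rewrite ord1 mxE.
by apply/eqP; rewrite -sqrf_eq0 eq_le sqr_ge0 -u0 sqr_coord_le.
Qed.

Lemma enorm_dot n (u : 'cV[R]_n) : enorm u = Num.sqrt (dot u u).
Proof. by rewrite /enorm dotE; under eq_bigr do rewrite expr2. Qed.

End dot.

(** * Convergence and differentiation of matrix-valued functions *)

Section matrix_calculus.
Variable R : realType.

Lemma cvg_mxP T (F : set_system T) {FF : Filter F} m n
    (g : T -> 'M[R]_(m, n)) (l : 'M[R]_(m, n)) :
  g t @[t --> F] --> l <-> forall i j, g t i j @[t --> F] --> l i j.
Proof.
split=> [gl i j|gl].
  exact: (cvg_comp _ _ gl (@coord_continuous _ _ _ i j l)).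
apply/cvg_ballP => e e0.
have : \forall t \near F, forall i j, ball (l i j) e (g t i j).
  apply: filter_forall => i; apply: filter_forall => j.
  by move/cvg_ballP : (gl i j); exact.
exact: filterS.
Qed.

Lemma cvg_mulmx (T : Type) (F : set_system T) {FF : Filter F} m n p
    (A : 'M[R]_(m, n)) (u : T -> 'M[R]_(n, p)) (c : 'M[R]_(n, p)) :
  u t @[t --> F] --> c -> A *m u t @[t --> F] --> A *m c.
Proof.
move=> /cvg_mxP uc; apply/cvg_mxP => i j.
rewrite mxE (_ : (fun t => (A *m u t) i j) = (fun t => \sum_k A i k * u t k j)).
  apply: cvg_big => [|k _]; first exact: add_continuous.
  by apply: cvgMr; exact: uc.
by apply/funext => t; rewrite mxE.
Qed.

Lemma cvg_dot (T : Type) (F : set_system T) {FF : Filter F} n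
    (u v : T -> 'cV[R]_n) (c d : 'cV[R]_n) :
  u t @[t --> F] --> c -> v t @[t --> F] --> d ->
  dot (u t) (v t) @[t --> F] --> dot c d.
Proof.
move=> /cvg_mxP uc /cvg_mxP vd.
rewrite dotE (_ : (fun t => dot (u t) (v t)) =
    (fun t => \sum_i u t i ord0 * v t i ord0)).
  apply: cvg_big => [|k _]; first exact: add_continuous.
  by apply: cvgM; [exact: uc|exact: vd].
by apply/funext => t; rewrite dotE.
Qed.
Lemma is_derive_mxP m n (g : R -> 'M[R]_(m, n)) (dg : 'M[R]_(m, n))
    (t : R) :
  is_derive t 1 g dg <-> forall i j, is_derive t 1 (fun s => g s i j) (dg i j).
Proof.
have E i j : (fun h => (h^-1 *: ((g \o shift t) (h *: 1) - g t)) i j) =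
    (fun h => h^-1 *: (((fun s => g s i j) \o shift t) (h *: 1) - g t i j)).
  by apply/funext => h; rewrite !mxE.
split=> [[dg1 dg2] i j|gij].
  have cg : h^-1 *: ((g \o shift t) (h *: 1) - g t) @[h --> 0^'] --> dg.
    by rewrite -dg2; exact: dg1.
  have /cvg_mxP/(_ i j) := cg; rewrite E => cgij.
  by apply: DeriveDef; [apply/cvg_ex; exists (dg i j)|exact: cvg_lim cgij].
have cg : h^-1 *: ((g \o shift t) (h *: 1) - g t) @[h --> 0^'] --> dg.
  apply/cvg_mxP => i j; rewrite E; have [d1 d2] := gij i j.
  by rewrite -d2; exact: d1.
by apply: DeriveDef; [apply/cvg_ex; exists dg|exact: cvg_lim cg].
Qed.

Lemma is_derive_dot n (u v : R -> 'cV[R]_n) (du dv : 'cV[R]_n)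
    (t : R) :
  is_derive t 1 u du -> is_derive t 1 v dv ->
  is_derive t 1 (fun s => dot (u s) (v s)) (dot du (v t) + dot (u t) dv).
Proof.
move=> /is_derive_mxP ud /is_derive_mxP vd.
have -> : (fun s => dot (u s) (v s)) =
    \sum_(i < n) ((fun s => u s i ord0) * (fun s => v s i ord0)).
  by apply/funext => s; rewrite dotE fct_sumE.
have udi i := ud i ord0; have vdi i := vd i ord0.
apply: is_derive_eq; rewrite !dotE -big_split/=; apply: eq_bigr => i _.
by rewrite addrC /GRing.scale/= (mulrC (v t _ _)).
Qed.

Lemma derive_within_interior (V : normedModType R) (D : set R) (g : R -> V) (t : R) :
  D° t -> derivable_within D g t -> is_derive t 1 g (derive_within D g t).
Proof.
move=> Dt gt.
have nD : within D t^' = t^'.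
  apply/seteqP; split=> S; rewrite /within/=; last first.
    by apply: filterS => s St _.
  have tD : t^' D by apply: nbhs_dnbhs; exact: Dt.
  by apply: filterS2 tD => s Ds; exact.
have gl : diff_quotient g t s @[s --> t^'] --> derive_within D g t.
  by rewrite -nD; exact: gt.
have cg : h^-1 *: ((g \o shift t) (h *: 1) - g t) @[h --> 0^']
    --> derive_within D g t.
  have -> : (fun h => h^-1 *: ((g \o shift t) (h *: 1) - g t)) =
      (fun h => diff_quotient g t (h + t)).
    by apply/funext => h; rewrite /diff_quotient/= addrK /GRing.scale/= mulr1.
  apply: cvg_comp gl => S.
  move=> /nbhs_ballP[e /= e0 eS]; apply/nbhs_ballP; exists e => //= h /=.
  rewrite /ball/= sub0r normrN => he h0; apply: eS.
    by rewrite /ball/= opprD addrCA subrr addr0 normrN.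
  by apply: contra h0 => /eqP/(canRL (addrK _)); rewrite subrr => ->.
by apply: DeriveDef; [apply/cvg_ex; eexists; exact: cg|exact: cvg_lim cg].
Qed.
End matrix_calculus.

(** * Eventually bounded functions *)

Section eventually_bounded.
Variable R : realType.
Implicit Types f g : R -> R.

Definition eventually_bounded g := exists M : R, \forall t \near +oo, `|g t| <= M.

Lemma eventually_bounded_le f g :
  (\forall t \near +oo, `|f t| <= `|g t|) -> eventually_bounded g ->
  eventually_bounded f.
Proof.
by move=> fg [M gM]; exists M; apply: filterS2 fg gM => t; exact: le_trans.
Qed.

Lemma eventually_bounded_cst c : eventually_bounded (fun _ => c).
Proof. by exists `|c|; apply: nearW. Qed.

Lemma eventually_boundedD f g : eventually_bounded f -> eventually_bounded g ->
  eventually_bounded (fun t => f t + g t).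
Proof.
move=> [M fM] [N gN]; exists (M + N); apply: filterS2 fM gN => t ? ?.
by rewrite (le_trans (ler_normD _ _))// lerD.
Qed.

Lemma eventually_boundedM f g : eventually_bounded f -> eventually_bounded g ->
  eventually_bounded (fun t => f t * g t).
Proof.
move=> [M fM] [N gN]; exists (M * N); apply: filterS2 fM gN => t ? ?.
by rewrite normrM ler_pM.
Qed.

Lemma eventually_boundedN f : eventually_bounded f ->
  eventually_bounded (fun t => - f t).
Proof. by move=> [M fM]; exists M; apply: filterS fM => t; rewrite normrN. Qed.

Lemma eventually_boundedB f g : eventually_bounded f -> eventually_bounded g ->
  eventually_bounded (fun t => f t - g t).
Proof.
by move=> fb gb; apply: eventually_boundedD fb _; exact: eventually_boundedN.
Qed.

Lemma eventually_bounded_sum n (F : 'I_n -> R -> R) :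
  (forall i, eventually_bounded (F i)) ->
  eventually_bounded (fun t => \sum_i F i t).
Proof.
elim: n F => [|n IH] F Fb.
  under eq_fun do rewrite big_ord0; exact: eventually_bounded_cst.
under eq_fun do rewrite big_ord_recl; apply: eventually_boundedD => //.
by apply: IH => i.
Qed.

Lemma eventually_bounded_uniform n (F : 'I_n -> R -> R) :
  (forall i, eventually_bounded (F i)) ->
  exists M : R, \forall t \near +oo, forall i, `|F i t| <= M.
Proof.
move=> Fb; have [|M MF] := @eventually_bounded_sum n (fun i t => `|F i t|).
  move=> i; apply: eventually_bounded_le (Fb i).
  by apply: nearW => t; rewrite normr_id.
exists M; apply: filterS MF => t Mt i; apply: le_trans Mt.
rewrite (le_trans _ (ler_norm _))// (bigD1 i)//= lerDl sumr_ge0//.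
Qed.

Lemma cvg_eventually_bounded f (l : R) :
  f t @[t --> +oo] --> l -> eventually_bounded f.
Proof.
move=> fl; exists (`|l| + 1); apply: (cvgr_norm_le l fl).
by rewrite ltrDl.
Qed.

Lemma eventually_bounded_cvg0 f g : eventually_bounded f ->
  g t @[t --> +oo] --> 0 -> f t * g t @[t --> +oo] --> 0.
Proof.
move=> [M fM] g0; apply/cvgr0Pnorm_le => e e0.
have M0 : 0 < `|M| + 1 by rewrite ltr_pwDr.
have ge : \forall t \near +oo, `|g t| <= e / (`|M| + 1).
  by move/cvgr0Pnorm_le : g0; apply; rewrite divr_gt0.
apply: filterS2 fM ge => t ft gt; rewrite normrM.
rewrite (@le_trans _ _ ((`|M| + 1) * (e / (`|M| + 1))))//.
  by rewrite ler_pM// (le_trans ft)// (le_trans (ler_norm _))// lerDl.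
by rewrite mulrCA divff ?mulr1// gt_eqF.
Qed.

End eventually_bounded.

(** * Differential inequalities on a half-line *)

Section scalar_derivatives.
Variable R : realType.
Implicit Types (f g : R -> R) (t : R).

Lemma is_derive_addf f g df dg t : is_derive t 1 f df -> is_derive t 1 g dg ->
  is_derive t 1 (fun s => f s + g s) (df + dg).
Proof. by move=> fd gd; exact: (@is_deriveD _ _ _ f g). Qed.

Lemma is_derive_oppf f df t : is_derive t 1 f df ->
  is_derive t 1 (fun s => - f s) (- df).
Proof. by move=> fd; exact: (@is_deriveN _ _ _ f). Qed.

Lemma is_derive_mulf f g df dg t : is_derive t 1 f df -> is_derive t 1 g dg ->
  is_derive t 1 (fun s => f s * g s) (f t * dg + g t * df).
Proof. by move=> fd gd; exact: (@is_deriveM _ _ f g). Qed.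

Lemma is_derive_sqrf f df t : is_derive t 1 f df ->
  is_derive t 1 (fun s => f s ^+ 2) (2 * f t * df).
Proof.
move=> fd; have := @is_deriveX _ _ f 2 t 1 df fd.
by rewrite expr1 /GRing.scale/=; congr is_derive.
Qed.

Lemma is_derive_invf f df t : f t != 0 -> is_derive t 1 f df ->
  is_derive t 1 (fun s => (f s)^-1) (- (f t) ^- 2 * df).
Proof.
by move=> f0 [fd <-]; apply: DeriveDef; [exact: derivableV|exact: deriveV].
Qed.

Lemma is_derive_lnf f df t : 0 < f t -> is_derive t 1 f df ->
  is_derive t 1 (fun s => ln (f s)) (df / f t).
Proof.
move=> f0 fd; have lnd := is_derive1_ln f0.
by have := is_derive1_comp lnd fd; rewrite mulrC.
Qed.

Lemma is_derive_expRf f df t : is_derive t 1 f df ->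
  is_derive t 1 (fun s => expR (f s)) (df * expR (f t)).
Proof.
by move=> fd; have := is_derive1_comp (is_derive_expR (f t)) fd; rewrite mulrC.
Qed.

Lemma is_derive_idf t : is_derive t 1 (fun s : R => s) 1.
Proof. exact: is_derive_id. Qed.

Lemma is_derive_cstf (c : R) t : is_derive t 1 (fun _ : R => c) 0.
Proof. exact: is_derive_cst. Qed.

Lemma nonincreasing_of_derive_le0 f df T :
  (forall t, T < t -> is_derive t 1 f (df t)) ->
  forall s t, T < s -> s <= t -> (forall u, s <= u -> df u <= 0) -> f t <= f s.
Proof.
move=> fd s t Ts st df0.
have [||c cst E] := @MVT_segment R f df s t st.
- by move=> c /[!in_itv]/= /andP[sc _]; exact/fd/(lt_trans Ts).
- apply: derivable_within_continuous => c /[!in_itv]/= /andP[sc _].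
  by have [] := fd c (lt_le_trans Ts sc).
rewrite -subr_le0 E mulr_le0_ge0 ?subr_ge0//; apply: df0.
by move: cst; rewrite in_itv/= => /andP[].
Qed.

Lemma nonincreasing_cvg_ge0 f T : (forall t, T < t -> 0 <= f t) ->
  (forall s t, T < s -> s <= t -> f t <= f s) ->
  exists c : R, f t @[t --> +oo] --> c.
Proof.
move=> f0 fd; pose S := f @` [set t | T < t].
have S0 : S !=set0 by exists (f (T + 1)), (T + 1) => //=; rewrite ltrDl.
have Sinf : has_inf S by split=> //; exists 0 => _ [t Tt <-]; exact: f0.
exists (inf S); apply/cvgrPdist_le => e e0.
have [_ [s /= Ts <-] fs] := inf_adherent e0 Sinf.
near=> t; have st : s <= t.
  by near: t; apply: nbhs_pinfty_ge; exact: num_real.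
have ft := fd _ _ Ts st.
have inft : inf S <= f t.
  by apply: ge_inf; [case: Sinf|exists t => //=; exact: lt_le_trans st].
by rewrite ler_norml; apply/andP; split; lra.
Unshelve. all: by end_near. Qed.

Lemma ln_cvgy : (ln t : R) @[t --> +oo] --> +oo.
Proof.
apply/cvgryPge => A; near=> t.
have At : expR A <= t by near: t; apply: nbhs_pinfty_ge; exact: num_real.
by rewrite -(expRK A) ler_ln ?posrE ?expR_gt0// (lt_le_trans (expR_gt0 A)).
Unshelve. all: by end_near. Qed.

End scalar_derivatives.

(* Derivatives of atoms, of quotients and of logarithms are taken from the
   context. *)
Ltac derive_arith := repeat first [eassumption
  | apply: is_derive_cstf | apply: is_derive_idf
  | eapply is_derive_addf | eapply is_derive_oppf | eapply is_derive_sqrf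
  | eapply is_derive_mulf | eapply is_derive_expRf].

Tactic Notation "derive_by" tactic(tac) :=
  eapply is_derive_eq; [derive_arith|cbn beta; tac].

Section relaxation.
Variable R : realType.

Section integrating_factor.
Variables (T : R) (L a h r : R -> R).
Hypothesis L_derive : forall t, T < t -> is_derive t 1 L (a t).
Hypothesis a_ge0 : forall t, T < t -> 0 <= a t.
Hypothesis h_derive : forall t, T < t -> is_derive t 1 h (a t * (r t - h t)).

(** [expR L] is an integrating factor: the derivative of
    [(h - M) * expR L] is [a * (r - M) * expR L]. *)
Lemma relaxation_decay M s t : T < s -> s <= t ->
  (forall u, s <= u -> r u <= M) -> h t - M <= expR (L s - L t) * (h s - M).
Proof.
move=> Ts st rM.
have E := @nonincreasing_of_derive_le0 R (fun u => (h u - M) * expR (L u))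
  (fun u => a u * expR (L u) * (r u - M)) T _ s t Ts st.
rewrite expRB mulrAC ler_pdivlMr ?expR_gt0// [leRHS]mulrC; apply: E.
- move=> u Tu; have Lu := L_derive Tu; have hu := h_derive Tu.
  by derive_by ring.
- move=> u su; rewrite mulr_ge0_le0 ?subr_le0 ?rM// mulr_ge0 ?expR_ge0//.
  by rewrite a_ge0// (lt_le_trans Ts).
Qed.

Lemma relaxation_weight_le1 s t : T < s -> s <= t -> expR (L s - L t) <= 1.
Proof.
move=> Ts st; rewrite expR_le1 subr_le0 -lerN2.
apply: (@nonincreasing_of_derive_le0 R (fun u => - L u) (fun u => - a u) T) st _ => //.
- by move=> u Tu; have Lu := L_derive Tu; exact: is_derive_oppf.
- by move=> u su; rewrite oppr_le0 a_ge0// (lt_le_trans Ts).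
Qed.

Lemma relaxation_ub M : (\forall t \near +oo, r t <= M) ->
  exists N, \forall t \near +oo, h t <= N.
Proof.
move=> [T1 [_ rM]]; pose s := Num.max T T1 + 1.
have Ts : T < s by rewrite /s ltr_pwDr// le_max lexx.
have T1s : T1 < s by rewrite /s ltr_pwDr// le_max lexx orbT.
exists (M + `|h s - M|); exists s; split=> [|t st]; first exact: num_real.
rewrite -lerBlDl; apply: le_trans (relaxation_decay Ts (ltW st) (M := M) _) _.
  by move=> u su; apply: rM; exact: lt_le_trans T1s su.
apply: (le_trans (ler_norm _)); rewrite normrM ger0_norm ?expR_ge0//.
by rewrite ler_piMl// relaxation_weight_le1// ltW.
Qed.

(** The weight [expR (L s - L t)] of the initial value tends to zero. *)
Lemma relaxation_limsup M e : 0 < e -> L t @[t --> +oo] --> +oo ->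
  (\forall t \near +oo, r t <= M) -> \forall t \near +oo, h t <= M + e.
Proof.
move=> e0 Loo [T1 [_ rM]]; pose s := Num.max T T1 + 1.
have Ts : T < s by rewrite /s ltr_pwDr// le_max lexx.
have T1s : T1 < s by rewrite /s ltr_pwDr// le_max lexx orbT.
pose k := 1 + `|h s - M|; have k0 : 0 < k by rewrite ltr_pwDl.
near=> t.
have st : s <= t by near: t; apply: nbhs_pinfty_ge; exact: num_real.
rewrite -lerBlDl; apply: le_trans (relaxation_decay Ts st (M := M) _) _.
  by move=> u su; apply: rM; exact: lt_le_trans T1s su.
have kt : expR (L s - L t) <= e / k.
  rewrite -[leRHS]lnK ?posrE ?divr_gt0// ler_expR lerBlDr -lerBlDl.
  by near: t; move/cvgryPge : Loo; exact.
apply: (@le_trans _ _ (expR (L s - L t) * k)).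
  by rewrite ler_wpM2l ?expR_ge0// (le_trans (ler_norm _))// lerDr.
by rewrite -ler_pdivlMr.
Unshelve. all: by end_near. Qed.

End integrating_factor.

Section two_sided.
Variables (T : R) (L a h r : R -> R).
Hypothesis L_derive : forall t, T < t -> is_derive t 1 L (a t).
Hypothesis a_ge0 : forall t, T < t -> 0 <= a t.
Hypothesis h_derive : forall t, T < t -> is_derive t 1 h (a t * (r t - h t)).

Let hN_derive t : T < t ->
  is_derive t 1 (fun u => - h u) (a t * ((fun u => - r u) t - - h t)).
Proof. by move=> Tt; have hd := h_derive Tt; derive_by ring. Qed.

Lemma relaxation_bounded :
  eventually_bounded r -> eventually_bounded h.
Proof.
move=> [M rM].
have [|N1 hN1] := relaxation_ub L_derive a_ge0 h_derive (M := M).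
  by apply: filterS rM => t; rewrite ler_norml => /andP[].
have [|N2 hN2] := relaxation_ub L_derive a_ge0 hN_derive (M := M).
  by apply: filterS rM => t; rewrite ler_norml lerNl => /andP[].
exists (Num.max N1 N2); apply: filterS2 hN1 hN2 => t h1 h2.
by rewrite ler_norml lerNl !le_max h1 h2 orbT.
Qed.

Lemma relaxation_cvg (l : R) : L t @[t --> +oo] --> +oo ->
  r t @[t --> +oo] --> l -> h t @[t --> +oo] --> l.
Proof.
move=> Loo rl; apply/cvgrPdist_le => e e0.
have e20 : 0 < e / 2 by rewrite divr_gt0.
have re : \forall t \near +oo, `|l - r t| <= e / 2.
  by move/cvgrPdist_le : rl; exact.
have := @relaxation_limsup T L a h r L_derive a_ge0 h_derive (l + e / 2) _ e20 Loo.
have := @relaxation_limsup T L a _ _ L_derive a_ge0 hN_derive (- l + e / 2) _ e20 Loo.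
have r1 : \forall t \near +oo, - r t <= - l + e / 2.
  by apply: filterS re => t; rewrite ler_norml => /andP[? ?]; lra.
have r2 : \forall t \near +oo, r t <= l + e / 2.
  by apply: filterS re => t; rewrite ler_norml => /andP[? ?]; lra.
move=> /(_ r1) h1 /(_ r2) h2.
by apply: filterS2 h1 h2 => t ? ?; rewrite ler_norml; apply/andP; split; lra.
Qed.

End two_sided.

(** The equation [u + theta * t * u' = r] relaxes [u] towards [r] at the rate
    [1 / (theta * t)], whose primitive [ln t / theta] diverges. *)
Section euler.
Variables (T theta : R) (u u' : R -> R).
Hypotheses (T_ge0 : 0 <= T) (theta_gt0 : 0 < theta).
Hypothesis u_derive : forall t, T < t -> is_derive t 1 u (u' t).

Let r t := u t + theta * t * u' t.
Let a t := t^-1 * theta^-1.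

Let L_derive t : T < t -> is_derive t 1 (fun s => ln s * theta^-1) (a t).
Proof.
move=> Tt; have lnd := is_derive1_ln (le_lt_trans T_ge0 Tt).
by derive_by (rewrite /a; ring).
Qed.

Let a_ge0 t : T < t -> 0 <= a t.
Proof.
by move=> Tt; rewrite mulr_ge0// invr_ge0 ltW// (le_lt_trans T_ge0).
Qed.

Let u_relax t : T < t -> is_derive t 1 u (a t * (r t - u t)).
Proof.
move=> Tt; have t0 := le_lt_trans T_ge0 Tt; have ud := u_derive Tt.
by apply: is_derive_eq; rewrite /a /r; field; rewrite !gt_eqF.
Qed.

Lemma euler_bounded : eventually_bounded r -> eventually_bounded u.
Proof. exact: relaxation_bounded L_derive a_ge0 u_relax. Qed.

Lemma euler_cvg (l : R) : r t @[t --> +oo] --> l -> u t @[t --> +oo] --> l.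
Proof.
apply: relaxation_cvg L_derive a_ge0 u_relax _ _.
by apply: gt0_cvgMly; [rewrite invr_gt0|exact: ln_cvgy].
Qed.

End euler.

End relaxation.

(** * Compactness and cluster points *)

Section cluster_points.

(** Otherwise the filter would meet the compact part of [K] on which [G] avoids
    some neighbourhood of [c], and it would have a cluster point there. *)
Lemma cvg_of_cluster (T U : topologicalType) (F : set_system T)
    {PF : ProperFilter F} (K : set T) (G : T -> U) (c : U) :
  compact K -> F K -> continuous G -> (forall p, cluster F p -> G p = c) ->
  G p @[p --> F] --> c.
Proof.
move=> cK FK cG Gc V; rewrite nbhsE => -[W [oW Wc] WV].
rewrite nbhs_simpl/=; apply: contrapT => nFV.
pose B := K `&` ~` (G @^-1` W).
have cB : compact B.
  by apply: compact_closedI => //; apply/open_closedC/open_comp.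
have pB : ProperFilter (within B F).
  split; last exact: within_filter.
  rewrite /within/= => FB; apply: nFV; apply: filterS2 FK FB => p Kp nBp.
  by apply: WV; apply: contrapT => nWp; apply: nBp.
have [p [[Kp nOp] pF]] := cB _ pB (withinT _ _).
apply: nOp; rewrite /preimage/= (Gc p)// => S S' FS.
by apply: pF; apply: filterS FS.
Qed.

Lemma cluster_cvg_eq (T U : topologicalType) (F : set_system T)
    {FF : Filter F} (H : T -> U) (p : T) (c : U) :
  hausdorff_space U -> cluster F p -> {for p, continuous H} ->
  H q @[q --> F] --> c -> H p = c.
Proof.
move=> hU Fp Hp Hc; apply/esym; apply: hU => A B cA pB.
have [q [Aq Bq]] := Fp _ _ (Hc _ cA) (Hp _ pB).
by exists (H q).
Qed.

Lemma compact_box (R : realType) n (M : R) :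
  compact [set v : 'cV[R]_n | forall i, `|v i ord0| <= M].
Proof.
have cr : compact [set v : 'rV[R]_n | forall i, `[- M, M]%classic (v ord0 i)].
  apply: (@rV_compact _ _ (fun=> `[- M, M]%classic)) => _.
  exact: segment_compact.
have ct : continuous (@trmx R 1 n).
  move=> v; apply/(@cvg_mxP R _ (nbhs v)) => i j; rewrite !mxE.
  rewrite (_ : (fun t : _ => _) = (fun w : 'rV[R]_n => w j i)).
    exact: coord_continuous.
  by apply/funext=> w; rewrite mxE.
have -> : [set v : 'cV[R]_n | forall i, `|v i ord0| <= M] =
    trmx @` [set v : 'rV[R]_n | forall i, `[- M, M]%classic (v ord0 i)].
  apply/seteqP; split=> [v vM|_ [v vM <-] i].
    by exists v^T; rewrite ?trmxK// => i; rewrite /= mxE in_itv/= -ler_norml.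
  by rewrite mxE ler_norml; have := vM i; rewrite /= in_itv.
apply: continuous_compact cr; exact: continuous_subspaceT.
Qed.

End cluster_points.

(** * Smooth convex functions *)

Section convex_functions.
Variables (R : realType) (n : nat) (f : 'cV[R]_n -> R).
Hypothesis f_diff : forall x, differentiable f x.

Lemma diff_grad x d : 'd f x d = dot (grad f x) d.
Proof.
rewrite {1}(matrix_sum_delta d) linear_sum dotE; apply: eq_bigr => i _.
by rewrite big_ord1 linearZ/= mxE deriveE// mulrC.
Qed.

Lemma is_derive_along (x : R -> 'cV[R]_n) dx (t : R) : is_derive t 1 x dx ->
  is_derive t 1 (fun s => f (x s)) (dot (grad f (x t)) dx).
Proof.
move=> [xd <-]; have xD : differentiable x t by exact/derivable1_diffP.
have fxD : differentiable (f \o x) t by exact: differentiable_comp.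
apply: DeriveDef; first exact/derivable1_diffP.
by rewrite -diff_grad !deriveE// diff_comp.
Qed.

Let line_derive x d (h : R) :
  is_derive h 1 (fun k : R => f (x + k *: d)) (dot (grad f (x + h *: d)) d).
Proof.
apply: is_derive_along; apply/is_derive_mxP => i j.
under eq_fun do rewrite !mxE.
by derive_by ring.
Qed.

(** The function [f (x + h *: d) - h * c] of [h] is minimal at [0]. *)
Lemma grad_of_support x d (c : R) :
  (forall h : R, f x + h * c <= f (x + h *: d)) -> dot (grad f x) d = c.
Proof.
move=> xmin; have ld h := line_derive x d h.
have phi_derive (h : R) : is_derive h 1 (fun k : R => f (x + k *: d) - k * c)
    (dot (grad f (x + h *: d)) d - c).
  by have ldh := ld h; derive_by ring.
have phi_min h : h \in `]-1, 1[%R ->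
    f (x + 0 *: d) - 0 * c <= f (x + h *: d) - h * c.
  by move=> _; rewrite scale0r addr0 mul0r subr0 lerBrDr.
have phi0 := @derive1_at_min R _ (- 1) 1 0 _
  (fun h _ => @ex_derive _ _ _ _ _ _ _ (phi_derive h)) _ phi_min.
have /phi0 {}phi0 : - 1 <= 1 :> R by lra.
have [|_ d0] := phi0; first by rewrite in_itv/= ltrN10 ltr01.
have [_] := phi_derive 0; rewrite d0 scale0r addr0 => /esym/eqP.
by rewrite subr_eq0 => /eqP.
Qed.

Hypothesis f_convex : convex_function [set: convex_lmodType 'cV[R]_n] f.

(** On the segment from [x] to [y] the difference quotients of [f] at [x] are at
    most [f y - f x]. *)
Lemma convex_above_tangent x y : f x + dot (grad f x) (y - x) <= f y.
Proof.
rewrite -lerBrDl; have [] := line_derive x (y - x) 0; rewrite scale0r addr0 => fD <-.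
pose phi (h : R) := f (x + h *: (y - x)).
have fl : h^-1 *: ((phi \o shift 0) (h *: 1) - phi 0) @[h --> 0^'+]
    --> 'D_1 phi 0.
  exact: cvg_dnbhs_at_right fD.
apply: (cvgr_to_le fl); near=> h.
have h0 : 0 < h by near: h; exact: nbhs_right_gt.
have h1 : h <= 1 by near: h; exact: nbhs_right_le.
rewrite /phi /= {1}/GRing.scale/= [h *: 1]mulr1 addr0 scale0r addr0 ler_pdivrMl//.
have := f_convex (Itv01 (ltW h0) h1) (in_setT y) (in_setT x).
have -> : conv (Itv01 (ltW h0) h1) (y : convex_lmodType 'cV[R]_n) x =
    x + h *: (y - x) :> 'cV[R]_n.
  by rewrite /conv/= /unstable.onem scalerBl scale1r scalerBr addrCA.
move=> cvx; have {}cvx : f (x + h *: (y - x)) <= h * f y + (1 - h) * f x := cvx.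
lra.
Unshelve. all: by end_near. Qed.

End convex_functions.

Section lagrange.
Variables (R : realType) (n m : nat) (A : 'M[R]_(m, n)).

(** A row vector lies in the row space of [A] as soon as it annihilates
    [cokermx A], and the columns of [cokermx A] lie in the kernel of [A]. *)
Lemma orthogonal_kernel (g : 'cV[R]_n) :
  (forall d, A *m d = 0 -> dot g d = 0) -> exists l, g + A^T *m l = 0.
Proof.
move=> gA; suff /submxP[D gE] : (g^T <= A)%MS.
  exists (- D^T); apply: trmx_inj.
  by rewrite linearD/= gE mulmxN linearN/= trmx_mul !trmxK trmx0 subrr.
rewrite submxE; apply/eqP/matrixP => i j; rewrite ord1 [RHS]mxE.
have Ac : A *m col j (cokermx A) = 0 by rewrite colE mulmxA mulmx_coker mul0mx.
by have := gA _ Ac; rewrite /dot colE mulmxA -colE mxE.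
Qed.

End lagrange.

(** * The energy of a trajectory *)

Lemma is_derive_mulmx (R : realType) n m (A : 'M[R]_(m, n))
    (x : R -> 'cV[R]_n) dx (t : R) :
  is_derive t 1 x dx -> is_derive t 1 (fun s => A *m x s) (A *m dx).
Proof.
move=> xd; apply/is_derive_mxP => i j; rewrite ord1.
have E v : (A *m v) i ord0 = dot (row i A)^T v.
  by rewrite /dot trmxK -row_mul [RHS]mxE.
under eq_fun do rewrite E.
rewrite E; have := is_derive_dot (is_derive_cst (row i A)^T t 1) xd.
by rewrite dot0l add0r.
Qed.

Lemma dot_trmxr (R : realType) n m (A : 'M[R]_(m, n)) u v :
  dot u (A^T *m v) = dot v (A *m u).
Proof. by rewrite dotC dot_trmx. Qed.

Lemma is_derive_subcst (R : realType) k (u : R -> 'cV[R]_k) (c du : 'cV[R]_k)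
    (t : R) : is_derive t 1 u du -> is_derive t 1 (fun s => u s - c) du.
Proof.
move=> /is_derive_mxP ud; apply/is_derive_mxP => i j; have udij := ud i j.
under eq_fun do rewrite !mxE.
by derive_by ring.
Qed.

Lemma is_derive_extrapolation (R : realType) k (u u' : R -> 'cV[R]_k)
    (c du' : 'cV[R]_k) (theta t : R) :
  is_derive t 1 u (u' t) -> is_derive t 1 u' du' ->
  is_derive t 1 (fun s => u s - c + (theta * s) *: u' s)
    ((1 + theta) *: u' t + (theta * t) *: du').
Proof.
move=> /is_derive_mxP ud /is_derive_mxP u'd; apply/is_derive_mxP => i j.
have udij := ud i j; have u'dij := u'd i j.
under eq_fun do rewrite !mxE.
by derive_by (rewrite !mxE; ring).
Qed.

Lemma continuous_affine (R : realType) n m (A : 'M[R]_(m, n)) (b : 'cV[R]_m) :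
  continuous (fun y : 'cV[R]_n => A *m y - b).
Proof.
move=> p.
have Ap : A *m y @[y --> p] --> A *m p.
  exact: (@cvg_mulmx R _ (nbhs p) _ m n 1 A id p cvg_id).
exact: cvgB Ap (cvg_cst b).
Qed.

Section lyapunov.
Variables (R : realType) (n m : nat) (f : 'cV[R]_n -> R).
Variables (A : 'M[R]_(m, n)) (b : 'cV[R]_m) (T alpha theta beta : R).
Variables (delta delta' : R -> R).
Variables (x x' x'' : R -> 'cV[R]_n) (l l' l'' : R -> 'cV[R]_m).

Hypothesis f_diff : forall y, differentiable f y.
Hypothesis grad_continuous : continuous (grad f).
Hypothesis f_convex : convex_function [set: convex_lmodType 'cV[R]_n] f.
Hypothesis T_gt0 : 0 < T.
Hypothesis theta_gt0 : 0 < theta.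
Hypothesis alpha_theta : 1 <= theta * (alpha - 1).
Hypothesis beta_ge0 : 0 <= beta.
Hypothesis delta_gt0 : forall t, T < t -> 0 < delta t.
Hypothesis delta_derive : forall t, T < t -> is_derive t 1 delta (delta' t).
Hypothesis delta_lim : t ^+ 2 * delta t @[t --> +oo] --> +oo.
Variable K : R.
Hypothesis slope_lb : forall t, T < t -> K <= t * delta' t / delta t.
Hypothesis slope_ub : forall t, T < t ->
  t * delta' t / delta t <= theta^-1 - 2.
Hypothesis x_derive : forall t, T < t -> is_derive t 1 x (x' t).
Hypothesis x'_derive : forall t, T < t -> is_derive t 1 x' (x'' t).
Hypothesis l_derive : forall t, T < t -> is_derive t 1 l (l' t).
Hypothesis l'_derive : forall t, T < t -> is_derive t 1 l' (l'' t).
Hypothesis x_eq : forall t, T < t ->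
  x'' t + (alpha / t) *: x' t
  + delta t *: (grad f (x t) + A^T *m (l t + (theta * t) *: l' t)
                + beta *: (A^T *m (A *m x t - b))) = 0.
Hypothesis l_eq : forall t, T < t ->
  l'' t + (alpha / t) *: l' t
  - delta t *: (A *m (x t + (theta * t) *: x' t) - b) = 0.

(** Excess over [f xs] of the augmented Lagrangian with multiplier [ls]. *)
Definition gap xs ls y := f y - f xs + dot ls (A *m y - b)
  + beta / 2 * dot (A *m y - b) (A *m y - b).

Let xi := theta * (alpha - 1) - 1.
Let vx xs t := x t - xs + (theta * t) *: x' t.
Let vl ls t := l t - ls + (theta * t) *: l' t.
Let speed2 t := dot (x' t) (x' t) + dot (l' t) (l' t).
Let dist2 xs ls t := dot (x t - xs) (x t - xs) + dot (l t - ls) (l t - ls).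

(** [theta * t] is the extrapolation step of the system, and the weight [xi] is
    the one for which the products of the position and the velocity cancel in
    the derivative. *)
Definition energy xs ls t := theta ^+ 2 * t ^+ 2 * delta t * gap xs ls (x t)
  + (dot (vx xs t) (vx xs t) + dot (vl ls t) (vl ls t)) / 2
  + xi / 2 * dist2 xs ls t.

(** At a saddle point the tangent of [f] is [f xs - dot ls (A *m y - b)]. *)
Lemma saddle_lagrangian_ge0 xs ls y : primal_dual_solutions f A b (xs, ls) ->
  0 <= f y - f xs + dot ls (A *m y - b).
Proof.
move=> [/= Axs gxs]; have := convex_above_tangent f_diff f_convex xs y.
have -> : grad f xs = - (A^T *m ls) by apply/eqP; rewrite -addr_eq0 gxs.
rewrite dotNl dot_trmx mulmxBr Axs.
lra.
Qed.

Lemma saddle_gap_ge0 xs ls y : primal_dual_solutions f A b (xs, ls) ->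
  0 <= gap xs ls y.
Proof.
move=> sol; rewrite addr_ge0 ?saddle_lagrangian_ge0// !mulr_ge0//.
exact: dot_ge0.
Qed.

Lemma gap_le_grad xs ls y : A *m xs = b -> gap xs ls y <=
  dot (grad f y) (y - xs) + dot ls (A *m (y - xs))
  + beta * dot (A *m (y - xs)) (A *m (y - xs)).
Proof.
move=> Axs; have := convex_above_tangent f_diff f_convex y xs.
rewrite /gap mulmxBr Axs -(opprB y) dotNr.
have := mulr_ge0 beta_ge0 (dot_ge0 (A *m y - b)).
lra.
Qed.

(** Here [X], [L] are the positions relative to the saddle point and [P], [Q]
    the velocities.  The acceleration of [X] contains [A^T] of the extrapolated
    multiplier and that of [L] contains [A] of the extrapolated position, with
    opposite signs, so that the two couplings cancel; and
    [1 + theta - theta * alpha] is [- xi]. *)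
Let energy_algebra (X P g : 'cV[R]_n) (L Q ls : 'cV[R]_m) (t d : R) : t != 0 ->
  dot (X + (theta * t) *: P) ((1 + theta) *: P + (theta * t) *:
    (- ((alpha / t) *: P) - d *: (g + A^T *m (L + ls + (theta * t) *: Q)
      + beta *: (A^T *m (A *m X)))))
  + dot (L + (theta * t) *: Q) ((1 + theta) *: Q + (theta * t) *:
    (- ((alpha / t) *: Q) + d *: (A *m (X + (theta * t) *: P))))
  + xi * (dot X P + dot L Q)
  = - (xi * theta * t * (dot P P + dot Q Q))
    - theta * t * d * (dot g X + dot ls (A *m X) + beta * dot (A *m X) (A *m X))
    - theta ^+ 2 * t ^+ 2 * d * (dot g P + dot ls (A *m P)
      + beta * dot (A *m X) (A *m P)).
Proof.
move=> t0; rewrite !(mulmxDr, =^~ scalemxAr) !dotDE !dot_trmxr.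
rewrite (dotC X g) (dotC P g) /xi.
by field.
Qed.

Let gap_derive xs ls t : A *m xs = b -> T < t ->
  is_derive t 1 (fun s => gap xs ls (x s))
  (dot (grad f (x t)) (x' t) + dot ls (A *m x' t)
   + beta * dot (A *m (x t - xs)) (A *m x' t)).
Proof.
move=> Axs Tt; have xd := x_derive Tt.
have fd := is_derive_along f_diff xd.
have rd := is_derive_subcst b (is_derive_mulmx A xd).
have rrd := is_derive_dot rd rd.
have lrd := is_derive_dot (is_derive_cst ls t 1) rd.
rewrite /gap; derive_by idtac.
rewrite mulmxBr Axs dot0l (dotC (A *m x' t)).
by field.
Qed.

Let x''E xs ls t : A *m xs = b -> T < t -> x'' t = - ((alpha / t) *: x' t)
  - delta t *: (grad f (x t) + A^T *m (l t - ls + ls + (theta * t) *: l' t)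
      + beta *: (A^T *m (A *m (x t - xs)))).
Proof.
move=> Axs Tt; have := x_eq Tt; rewrite subrK (mulmxBr A) Axs -addrA => /eqP.
by rewrite addr_eq0 => /eqP ->; rewrite opprD.
Qed.

Let l''E xs t : A *m xs = b -> T < t -> l'' t = - ((alpha / t) *: l' t)
  + delta t *: (A *m (x t - xs + (theta * t) *: x' t)).
Proof.
move=> Axs Tt; have := l_eq Tt; rewrite -addrA => /eqP.
by rewrite addr_eq0 => /eqP ->; rewrite opprB addrC addrAC mulmxBr Axs.
Qed.

Lemma energy_derive xs ls t : A *m xs = b -> T < t ->
  is_derive t 1 (energy xs ls)
  (theta ^+ 2 * (2 * t * delta t + t ^+ 2 * delta' t) * gap xs ls (x t)
   - theta * t * delta t * (dot (grad f (x t)) (x t - xs)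
       + dot ls (A *m (x t - xs)) + beta * dot (A *m (x t - xs)) (A *m (x t - xs)))
   - xi * theta * t * speed2 t).
Proof.
move=> Axs Tt; have t0 : t != 0 by rewrite gt_eqF// (lt_trans T_gt0).
have gd := gap_derive ls Axs Tt; have dd := delta_derive Tt.
have vx_derive := is_derive_extrapolation xs theta (x_derive Tt) (x'_derive Tt).
have vl_derive := is_derive_extrapolation ls theta (l_derive Tt) (l'_derive Tt).
have vxd := is_derive_dot vx_derive vx_derive.
have vld := is_derive_dot vl_derive vl_derive.
have xd := is_derive_subcst xs (x_derive Tt).
have ld := is_derive_subcst ls (l_derive Tt).
have xxd := is_derive_dot xd xd; have lld := is_derive_dot ld ld.
rewrite /energy /dist2; derive_by idtac.
have := energy_algebra (x t - xs) (x' t) (grad f (x t)) (l t - ls) (l' t) ls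
  (delta t) t0.
rewrite -x''E// -l''E// -/(vx xs t) -/(vl ls t) -/(speed2 t).
rewrite (dotC _ (vx xs t)) (dotC _ (vl ls t)).
rewrite (dotC (x' t) (x t - xs)) (dotC (l' t) (l t - ls)) => E.
lra.
Qed.

(* The slack in the upper bound on the logarithmic slope of [delta]. *)
Let ratio t := theta^-1 - 2 - t * delta' t / delta t.

(** The gap is convex and vanishes at [xs], so [gap_le_grad] bounds it by its
    derivative in the direction [x t - xs]. *)
Lemma energy_derive_ub xs ls t : A *m xs = b -> T < t ->
  theta ^+ 2 * (2 * t * delta t + t ^+ 2 * delta' t) * gap xs ls (x t)
   - theta * t * delta t * (dot (grad f (x t)) (x t - xs)
       + dot ls (A *m (x t - xs)) + beta * dot (A *m (x t - xs)) (A *m (x t - xs)))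
   - xi * theta * t * speed2 t
  <= - (theta ^+ 2 * t * delta t * ratio t * gap xs ls (x t))
     - xi * theta * t * speed2 t.
Proof.
move=> Axs Tt; have t0 : 0 < t by rewrite (lt_trans T_gt0).
have d0 := delta_gt0 Tt.
rewrite lerD2r -subr_ge0.
have -> : - (theta ^+ 2 * t * delta t * ratio t * gap xs ls (x t)) -
  (theta ^+ 2 * (2 * t * delta t + t ^+ 2 * delta' t) * gap xs ls (x t)
   - theta * t * delta t * (dot (grad f (x t)) (x t - xs)
       + dot ls (A *m (x t - xs)) + beta * dot (A *m (x t - xs)) (A *m (x t - xs))))
  = theta * t * delta t * (dot (grad f (x t)) (x t - xs)
       + dot ls (A *m (x t - xs)) + beta * dot (A *m (x t - xs)) (A *m (x t - xs))
       - gap xs ls (x t)).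
  by rewrite /ratio; field; rewrite !gt_eqF.
rewrite mulr_ge0 ?subr_ge0 ?gap_le_grad// !mulr_ge0// ltW//.
Qed.

Lemma energy_nonincreasing xs ls s t : primal_dual_solutions f A b (xs, ls) ->
  T < s -> s <= t -> energy xs ls t <= energy xs ls s.
Proof.
move=> sol Ts st; have [/= Axs _] := sol.
apply: (nonincreasing_of_derive_le0 (fun u Tu => energy_derive ls Axs Tu) Ts st).
move=> u su; have Tu := lt_le_trans Ts su; have u0 := lt_trans T_gt0 Tu.
apply: le_trans (energy_derive_ub ls Axs Tu) _.
have [u0' th0 d0] := And3 (ltW u0) (ltW theta_gt0) (ltW (delta_gt0 Tu)).
rewrite -opprD oppr_le0 addr_ge0//.
  have r0 : 0 <= ratio u by rewrite subr_ge0 slope_ub.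
  by rewrite !mulr_ge0 ?saddle_gap_ge0 ?sqr_ge0//.
have xi0 : 0 <= xi by rewrite subr_ge0.
have sp0 : 0 <= speed2 u by rewrite addr_ge0 ?dot_ge0.
by rewrite !mulr_ge0.
Qed.

Let after_T (P : R -> Prop) : (forall t, T < t -> P t) -> \forall t \near +oo, P t.
Proof. by move=> TP; exists T; split=> //; exact: num_real. Qed.

Let weight_gt0 t : T < t -> 0 < t ^+ 2 * delta t.
Proof.
by move=> Tt; rewrite mulr_gt0 ?exprn_gt0 ?delta_gt0// (lt_trans T_gt0).
Qed.

Let weightV_cvg0 : (t ^+ 2 * delta t)^-1 @[t --> +oo] --> 0.
Proof.
exact/(gtr0_cvgV0 (f := fun t => t ^+ 2 * delta t) (after_T weight_gt0)).
Qed.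

Lemma ratio_ge0 t : T < t -> 0 <= ratio t.
Proof. by move=> Tt; rewrite subr_ge0 slope_ub. Qed.

Let ratio_bounded : eventually_bounded ratio.
Proof.
exists (theta^-1 - 2 - K); apply: after_T => t Tt.
by rewrite ger0_norm ?ratio_ge0// lerB ?slope_lb.
Qed.

Let xi_ge0 : 0 <= xi. Proof. by rewrite subr_ge0. Qed.

(** ** Consequences of the boundedness of the energy *)

Section saddle_point.
Variables (xs : 'cV[R]_n) (ls : 'cV[R]_m).
Hypothesis sol : primal_dual_solutions f A b (xs, ls).

Let Axs : A *m xs = b. Proof. by case: sol. Qed.

Let energy_ge t : T < t ->
  0 <= xi / 2 * dist2 xs ls t /\ 0 <= theta ^+ 2 * t ^+ 2 * delta t * gap xs ls (x t).
Proof.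
move=> Tt; have d0 := ltW (delta_gt0 Tt); split.
  have dist_ge0 : 0 <= dist2 xs ls t by rewrite addr_ge0 ?dot_ge0.
  by rewrite !mulr_ge0.
have g0 := saddle_gap_ge0 (x t) sol.
by rewrite !mulr_ge0// ltW// (lt_trans T_gt0).
Qed.

Lemma energy_ge0 t : T < t -> 0 <= energy xs ls t.
Proof.
move=> Tt; have [e1 e2] := energy_ge Tt.
have := dot_ge0 (vx xs t); have := dot_ge0 (vl ls t).
by rewrite /energy; lra.
Qed.

Lemma energy_cvg : exists c : R, energy xs ls t @[t --> +oo] --> c.
Proof.
apply: (@nonincreasing_cvg_ge0 _ _ T) => [t|s t]; first exact: energy_ge0.
exact: energy_nonincreasing.
Qed.

Let energy_bounded : exists2 M : R, 0 <= M & \forall t \near +oo,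
  [/\ dot (vx xs t) (vx xs t) <= M, dot (vl ls t) (vl ls t) <= M
    & t ^+ 2 * delta t * gap xs ls (x t) <= M].
Proof.
have [c Ec] := energy_cvg; have [N EN] := cvg_eventually_bounded Ec.
exists (Num.max (2 * N) (N / theta ^+ 2)).
  apply: le_trans (_ : 2 * N <= _); last by rewrite le_max lexx.
  case: EN => N' [_ EN]; rewrite mulr_ge0//.
  by apply: le_trans (EN (N' + 1) _); rewrite ?normr_ge0// ltrDl.
apply: filterS2 (after_T (fun _ p => p)) EN => t Tt EN.
have := le_trans (ler_norm _) EN; rewrite /energy.
have [e1 e2] := energy_ge Tt.
have := dot_ge0 (vx xs t); have := dot_ge0 (vl ls t) => v1 v2 E.
split; rewrite le_max; apply/orP; [left|left|right].
- lra.
- lra.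
- by rewrite ler_pdivlMr ?exprn_gt0//; lra.
Qed.

(** A coordinate [w] of [u - c] solves [w + theta * t * w' = r] with [r]
    bounded, and [t * w'] is [(r - w) / theta]. *)
Let coord_bounded k (u u' : R -> 'cV[R]_k) c i :
  (forall t, T < t -> is_derive t 1 u (u' t)) ->
  (exists M : R, \forall t \near +oo,
    dot (u t - c + (theta * t) *: u' t) (u t - c + (theta * t) *: u' t) <= M) ->
  eventually_bounded (fun t => u t i ord0) /\
  eventually_bounded (fun t => t * u' t i ord0).
Proof.
move=> ud [M uM]; pose w t := u t i ord0 - c i ord0.
have wd t : T < t -> is_derive t 1 w (u' t i ord0).
  by move=> Tt; have /is_derive_mxP/(_ i ord0) udt := ud t Tt; derive_by ring.
have rb : eventually_bounded (fun t => w t + theta * t * u' t i ord0).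
  exists (1 + M); apply: filterS uM => t /(le_trans (sqr_coord_le _ i)).
  rewrite !mxE -/(w t); set r := w t + _ => rM.
  (* [`|r| <= 1 + r ^+ 2], from [0 <= (`|r| - 1) ^+ 2] *)
  have := sqr_ge0 (`|r| - 1); rewrite -(real_normK (num_real r)) in rM.
  have := normr_ge0 r.
  nra.
have wb := euler_bounded (ltW T_gt0) theta_gt0 wd rb.
split.
  have -> : (fun t => u t i ord0) = (fun t => w t + c i ord0).
    by apply/funext => t; rewrite subrK.
  by apply: eventually_boundedD wb _; exact: eventually_bounded_cst.
have -> : (fun t => t * u' t i ord0) =
    (fun t => theta^-1 * ((w t + theta * t * u' t i ord0) - w t)).
  by apply/funext => t; field; rewrite gt_eqF.
apply: eventually_boundedM; first exact: eventually_bounded_cst.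
exact: eventually_boundedB.
Qed.

Lemma x_bounded i : eventually_bounded (fun t => x t i ord0).
Proof.
have [M _ EM] := energy_bounded.
have [|//] := @coord_bounded n x x' xs i x_derive.
by exists M; apply: filterS EM => t [].
Qed.

Lemma x'_bounded i : eventually_bounded (fun t => t * x' t i ord0).
Proof.
have [M _ EM] := energy_bounded.
have [|//] := @coord_bounded n x x' xs i x_derive.
by exists M; apply: filterS EM => t [].
Qed.

Lemma l_bounded i : eventually_bounded (fun t => l t i ord0).
Proof.
have [M _ EM] := energy_bounded.
have [|//] := @coord_bounded m l l' ls i l_derive.
by exists M; apply: filterS EM => t [].
Qed.

Lemma l'_bounded i : eventually_bounded (fun t => t * l' t i ord0).
Proof.
have [M _ EM] := energy_bounded.
have [|//] := @coord_bounded m l l' ls i l_derive.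
by exists M; apply: filterS EM => t [].
Qed.

Lemma gap_cvg0 : gap xs ls (x t) @[t --> +oo] --> 0.
Proof.
have [M M0 EM] := energy_bounded.
have gb : eventually_bounded (fun t => t ^+ 2 * delta t * gap xs ls (x t)).
  exists M; apply: filterS2 (after_T weight_gt0) EM => t w0 [_ _].
  by rewrite ger0_norm// mulr_ge0 ?saddle_gap_ge0// ltW.
have := eventually_bounded_cvg0 gb weightV_cvg0.
apply: cvg_trans; apply: near_eq_cvg; apply: filterS (after_T weight_gt0) => t w0.
by rewrite mulrAC divff ?mul1r// gt_eqF.
Qed.

(** ** The residual of the constraint *)

Let res t : 'cV[R]_m := A *m x t - b.
Let g j t := theta * (t ^+ 2 * delta t) * res t j ord0.
Let r j t := t * l' t j ord0 + (alpha - 1) * l t j ord0.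
Let h j t := r j t - g j t.
Let rate t := ratio t * t^-1.
Let Lrate t := (theta^-1 - 2) * ln t - ln (delta t).

(* [expR (Lrate t)] is [t `^ (theta^-1 - 2) / delta t], that is,
   [t `^ theta^-1] divided by [t ^+ 2 * delta t]. *)
Let Lrate_derive t : T < t -> is_derive t 1 Lrate (rate t).
Proof.
move=> Tt; have t0 := lt_trans T_gt0 Tt; have d0 := delta_gt0 Tt.
have lnt := is_derive1_ln t0; have lnd := is_derive_lnf d0 (delta_derive Tt).
rewrite /Lrate; derive_by (rewrite /rate /ratio).
by field; rewrite !gt_eqF.
Qed.

Let rate_ge0 t : T < t -> 0 <= rate t.
Proof.
by move=> Tt; rewrite mulr_ge0 ?ratio_ge0// invr_ge0 ltW// (lt_trans T_gt0).
Qed.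

(** By the multiplier equation the derivative of [r j] is [t * delta t] times the
    extrapolated residual [res t + theta * t *: A x'].  It exceeds the derivative
    of [g j] by [rate t * g j t], and [g j] is [r j - h j]. *)
Lemma residual_relaxation j t : T < t ->
  is_derive t 1 (h j) (rate t * (r j t - h j t)).
Proof.
move=> Tt; have t0 := lt_trans T_gt0 Tt; have d0 := delta_gt0 Tt.
have /is_derive_mxP/(_ j ord0) ld := l_derive Tt.
have /is_derive_mxP/(_ j ord0) l'd := l'_derive Tt.
have /is_derive_mxP/(_ j ord0) resd :=
  is_derive_subcst b (is_derive_mulmx A (x_derive Tt)).
have dd := delta_derive Tt.
have E : l'' t j ord0 = - (alpha / t) * l' t j ord0
    + delta t * (res t j ord0 + theta * t * (A *m x' t) j ord0).
  have := congr1 (fun v : 'cV_m => v j ord0) (l_eq Tt).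
  rewrite /res mulmxDr -scalemxAr.
  by move: (A *m x t) (A *m x' t) => Ax Ax'; rewrite !mxE => ?; lra.
rewrite /h /r /g; derive_by (rewrite E /rate /ratio).
by field; rewrite !gt_eqF.
Qed.

Lemma residual_bounded j : eventually_bounded (g j).
Proof.
have rb : eventually_bounded (r j).
  apply: eventually_boundedD; first exact: l'_bounded.
  by apply: eventually_boundedM (l_bounded j); exact: eventually_bounded_cst.
have hb := relaxation_bounded Lrate_derive rate_ge0 (residual_relaxation j) rb.
rewrite (_ : g j = fun t => r j t - h j t); first exact: eventually_boundedB.
by apply/funext => t; rewrite /h subKr.
Qed.

Lemma residual_cvg0 : res t @[t --> +oo] --> (0 : 'cV[R]_m).
Proof.
apply/cvg_mxP => j k; rewrite ord1 mxE.
have gb : eventually_bounded (fun t => theta^-1 * g j t).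
  by apply: eventually_boundedM (residual_bounded j); exact: eventually_bounded_cst.
have := eventually_bounded_cvg0 gb weightV_cvg0.
apply: cvg_trans; apply: near_eq_cvg; apply: filterS (after_T weight_gt0) => t w0.
by rewrite /g; move: (t ^+ 2 * _) w0 => W w0; field; rewrite !gt_eqF.
Qed.

Lemma objective_cvg : f (x t) @[t --> +oo] --> f xs.
Proof.
have rr : dot (res t) (res t) @[t --> +oo] --> 0.
  by rewrite -(dot0r (0 : 'cV[R]_m)); apply: cvg_dot residual_cvg0 residual_cvg0.
have lr : dot ls (res t) @[t --> +oo] --> 0.
  by rewrite -(dot0r ls); apply: cvg_dot (cvg_cst _) residual_cvg0.
rewrite (_ : (fun t => f (x t)) = (fun t => gap xs ls (x t) + f xs
    - dot ls (res t) - beta / 2 * dot (res t) (res t))); last first.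
  by apply/funext => t; rewrite /gap -/(res t); lra.
have := cvgB (cvgB (cvgD gap_cvg0 (cvg_cst (f xs))) lr) (cvgM (cvg_cst (beta / 2)) rr).
by rewrite mulr0 !subr0 add0r; apply.
Qed.

(** A cluster point is feasible and has the value [f xs], so it minimizes the
    Lagrangian at the multiplier [ls]. *)
Lemma x_cluster p : cluster (x t @[t --> +oo]) p ->
  A *m p = b /\ grad f p = - (A^T *m ls).
Proof.
move=> xp.
have Ap : A *m p = b.
  apply/eqP; rewrite -subr_eq0; apply/eqP.
  apply: (cluster_cvg_eq (H := fun y => A *m y - b) _ xp _ residual_cvg0).
    exact: norm_hausdorff.
  exact: continuous_affine.
have fp : f p = f xs.
  apply: (cluster_cvg_eq _ xp _ objective_cvg) => //.
  exact: differentiable_continuous.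
split=> //; apply/eqP; rewrite -addr_eq0; apply/eqP/dot_eq0.
set d := grad f p + _; rewrite {1}/d dotDl dot_trmx.
rewrite (@grad_of_support _ _ _ f_diff p d (- dot ls (A *m d))) ?addNr// => k.
have := @saddle_lagrangian_ge0 xs ls (p + k *: d) sol.
rewrite mulmxDr Ap -scalemxAr [b + _ - b]addrAC subrr add0r dotZr fp.
lra.
Qed.

(** ** Convergence of the gradient and of the dual force *)

Lemma grad_cvg : grad f (x t) @[t --> +oo] --> - (A^T *m ls).
Proof.
have [M xM] := eventually_bounded_uniform x_bounded.
apply: (@cvg_of_cluster _ _ (x t @[t --> +oo]) _ _ (grad f) _
  (@compact_box R n M)) => //.
by move=> p /x_cluster[].
Qed.

(** The first equation divided by [delta] is
    [v + theta * t * v' = - (grad f x + A^T ls) - beta * A^T (A x - b)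
    - (x'' + (alpha / t) * x') / delta].  The last term need not tend to zero, but
    the corrector [y = x' / (theta * t * delta)] is such that [theta * t * y']
    cancels [x'' / delta] up to terms of the order of
    [t * x' / (t^2 * delta)]. *)
Lemma dual_cvg i : (A^T *m (l t - ls)) i ord0 @[t --> +oo] --> 0.
Proof.
pose v t := A^T *m (l t - ls); pose y t := x' t i ord0 / (theta * (t * delta t)).
pose e t := - (grad f (x t) + A^T *m ls) i ord0 - beta * (A^T *m res t) i ord0
  + (t ^+ 2 * delta t)^-1 * ((t * x' t i ord0) * (1 - alpha + ratio t)).
have y0 : y t @[t --> +oo] --> 0.
  have yb : eventually_bounded (fun t => theta^-1 * (t * x' t i ord0)).
    by apply: eventually_boundedM (x'_bounded i); exact: eventually_bounded_cst.
  have := eventually_bounded_cvg0 yb weightV_cvg0.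
  apply: cvg_trans; apply: near_eq_cvg; apply: after_T => t Tt; rewrite /y.
  by field; rewrite !gt_eqF ?delta_gt0// (lt_trans T_gt0).
have e0 : e t @[t --> +oo] --> 0.
  have g0 : (grad f (x t) + A^T *m ls) i ord0 @[t --> +oo] --> 0.
    have /cvg_mxP/(_ i ord0) :=
      [elaborate cvgD grad_cvg (cvg_cst (A^T *m ls))].
    by rewrite addNr mxE; apply.
  have r0 : (A^T *m res t) i ord0 @[t --> +oo] --> 0.
    have /cvg_mxP/(_ i ord0) := 
      [elaborate @cvg_mulmx R _ _ _ _ _ _ A^T _ _ residual_cvg0].
    by rewrite mulmx0 mxE; apply.
  have b0 : (t ^+ 2 * delta t)^-1 * ((t * x' t i ord0) * (1 - alpha + ratio t))
      @[t --> +oo] --> 0.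
    under eq_fun do rewrite mulrC.
    apply: eventually_bounded_cvg0 weightV_cvg0.
    apply: eventually_boundedM (x'_bounded i) _.
    by apply: eventually_boundedD ratio_bounded; exact: eventually_bounded_cst.
  have := [elaborate cvgD (cvgB (cvgN g0) (cvgM (cvg_cst beta) r0)) b0].
  by rewrite oppr0 mulr0 subr0 addr0; apply.
pose u t := v t i ord0 + y t.
pose u' t := (A^T *m l' t) i ord0
  + (x'' t i ord0 / (theta * (t * delta t))
     - x' t i ord0 * (delta t + t * delta' t) / (theta * (t * delta t) ^+ 2)).
have ud t : T < t -> is_derive t 1 u (u' t).
  move=> Tt; have t0 := lt_trans T_gt0 Tt; have d0 := delta_gt0 Tt.
  have /is_derive_mxP/(_ i ord0) vd :=
    is_derive_mulmx A^T (is_derive_subcst ls (l_derive Tt)).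
  have /is_derive_mxP/(_ i ord0) x'd := x'_derive Tt.
  have dd := delta_derive Tt.
  have pd : is_derive t 1 (fun s => theta * (s * delta s))
      (theta * (delta t + t * delta' t)) by derive_by ring.
  have p0 : theta * (t * delta t) != 0 by rewrite gt_eqF// !mulr_gt0.
  have ivd := @is_derive_invf R (fun s => theta * (s * delta s)) _ t p0 pd.
  rewrite /u /v /y; derive_by (rewrite /u').
  by field; rewrite !gt_eqF.
have ue t : T < t -> u t + theta * t * u' t = e t.
  move=> Tt; have t0 := lt_trans T_gt0 Tt; have d0 := delta_gt0 Tt.
  have x''i : x'' t i ord0 = - (alpha / t) * x' t i ord0
      - delta t * ((grad f (x t) + A^T *m ls) i ord0 + v t i ord0
        + theta * t * (A^T *m l' t) i ord0 + beta * (A^T *m res t) i ord0).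
    have := congr1 (fun w : 'cV_n => w i ord0) (x_eq Tt).
    rewrite /v /res (mulmxDr _ (l t)) (mulmxBr _ (l t)) -scalemxAr.
    move: (A^T *m (A *m x t - b)) (A^T *m l t) (A^T *m l' t) (A^T *m ls) (grad f (x t)).
    by move=> a1 a2 a3 a4 a5; rewrite !mxE => ?; lra.
  rewrite /u /u' /y /e x''i /ratio.
  by field; rewrite !gt_eqF.
have u0 : u t @[t --> +oo] --> 0.
  apply: (euler_cvg (ltW T_gt0) theta_gt0 ud).
  apply: cvg_trans e0; apply: near_eq_cvg.
  by apply: after_T => t Tt; rewrite ue.
rewrite (_ : (fun t => (A^T *m (l t - ls)) i ord0) = (fun t => u t - y t)).
  by have := [elaborate cvgB u0 y0]; rewrite subrr; apply.
by apply/funext => t; rewrite /u addrK.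
Qed.

Lemma dual_cluster q : cluster (l t @[t --> +oo]) q -> A^T *m q = A^T *m ls.
Proof.
have wl : A^T *m l t - A^T *m ls @[t --> +oo] --> (0 : 'cV[R]_n).
  apply/cvg_mxP => i j; rewrite ord1 mxE.
  rewrite (_ : (fun t => _) = (fun t => (A^T *m (l t - ls)) i ord0)).
    exact: dual_cvg.
  by apply/funext => t; rewrite mulmxBr.
move=> lq; apply/eqP; rewrite -subr_eq0; apply/eqP.
apply: (cluster_cvg_eq (H := fun y => A^T *m y - A^T *m ls) _ lq _ wl).
  exact: norm_hausdorff.
exact: continuous_affine.
Qed.

(** ** Rates when all the inequalities between the parameters are strict *)

Section strict_rates.
Hypothesis x_cvg : x t @[t --> +oo] --> xs.
Hypothesis l_cvg : l t @[t --> +oo] --> ls.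
Hypothesis alpha_theta_lt : 1 < theta * (alpha - 1).
Variable kappa : R.
Hypothesis kappa_gt0 : 0 < kappa.
Hypothesis ratio_ge : forall t, T < t -> kappa <= ratio t.

(* What remains of the energy in the limit, since [x - xs] and [l - ls] tend to
   zero while [t * x'] and [t * l'] stay bounded. *)
Let pot t := theta ^+ 2 * (t ^+ 2 * delta t * gap xs ls (x t)
  + t ^+ 2 * speed2 t / 2).

Let dot_cvg0 k (u v : R -> 'cV[R]_k) :
  (forall i, eventually_bounded (fun t => v t i ord0)) ->
  u t @[t --> +oo] --> (0 : 'cV[R]_k) -> dot (v t) (u t) @[t --> +oo] --> 0.
Proof.
move=> vb /cvg_mxP u0.
have sum0 : \sum_(i < k) v t i ord0 * u t i ord0 @[t --> +oo]
    --> (\sum_(i < k) 0 : R).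
  apply: cvg_big => [|i _]; first exact: add_continuous.
  by apply: eventually_bounded_cvg0 => //; have := u0 i ord0; rewrite mxE.
rewrite big1// in sum0.
rewrite (_ : (fun t => dot (v t) (u t)) =
  (fun t => \sum_(i < k) v t i ord0 * u t i ord0))//.
by apply/funext => t; rewrite dotE.
Qed.

Let energy_pot_cvg0 : energy xs ls t - pot t @[t --> +oo] --> 0.
Proof.
have X0 : x t - xs @[t --> +oo] --> (0 : 'cV[R]_n).
  by rewrite -(subrr xs); apply: cvgB x_cvg (cvg_cst _).
have L0 : l t - ls @[t --> +oo] --> (0 : 'cV[R]_m).
  by rewrite -(subrr ls); apply: cvgB l_cvg (cvg_cst _).
have XX := [elaborate cvg_dot X0 X0]; have LL := [elaborate cvg_dot L0 L0].
have XP : dot (t *: x' t) (x t - xs) @[t --> +oo] --> 0.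
  apply: dot_cvg0 X0 => i; rewrite (_ : (fun t => _) = fun t => t * x' t i ord0).
    exact: x'_bounded.
  by apply/funext => t; rewrite mxE.
have LP : dot (t *: l' t) (l t - ls) @[t --> +oo] --> 0.
  apply: dot_cvg0 L0 => i; rewrite (_ : (fun t => _) = fun t => t * l' t i ord0).
    exact: l'_bounded.
  by apply/funext => t; rewrite mxE.
rewrite !dot0r in XX LL.
rewrite (_ : (fun t => energy xs ls t - pot t) = (fun t =>
    (1 + xi) / 2 * (dot (x t - xs) (x t - xs) + dot (l t - ls) (l t - ls))
    + theta * (dot (t *: x' t) (x t - xs) + dot (t *: l' t) (l t - ls)))).
  have := [elaborate cvgD (cvgM (cvg_cst ((1 + xi) / 2)) (cvgD XX LL))
    (cvgM (cvg_cst theta) (cvgD XP LP))].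
  by rewrite addr0 !mulr0 addr0; apply.
apply/funext => t; rewrite /energy /pot /vx /vl /speed2 /dist2.
move: (x t - xs) (l t - ls) => X L; rewrite !dotDE (dotC X) (dotC L).
by lra.
Qed.

Let pot_ge0 t : T < t -> 0 <= pot t.
Proof.
move=> Tt; have d0 := ltW (delta_gt0 Tt); have t0 := ltW (lt_trans T_gt0 Tt).
have s0 : 0 <= speed2 t by rewrite addr_ge0 ?dot_ge0.
have g0 := saddle_gap_ge0 (x t) sol; have th0 := ltW theta_gt0.
by rewrite mulr_ge0 ?addr_ge0 ?mulr_ge0.
Qed.

(** If the limit [c] were positive, the derivative of the energy would be at
    most [- k * (c / 2) / t] eventually, and the energy would go to [-oo] like
    [- ln t]. *)
Let pot_cvg0 : pot t @[t --> +oo] --> 0.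
Proof.
have [c Ec] := energy_cvg.
have pc : pot t @[t --> +oo] --> c.
  rewrite (_ : pot = fun t => energy xs ls t - (energy xs ls t - pot t)).
    by have := [elaborate cvgB Ec energy_pot_cvg0]; rewrite subr0; apply.
  by apply/funext => t; rewrite subKr.
have c0 : 0 <= c by apply: (cvgr_to_ge pc); exact: after_T pot_ge0.
suff -> : 0 = c by [].
apply: contrapT => /eqP; rewrite eq_sym => cn0.
have {cn0 c0}c0 : 0 < c by rewrite lt_neqAle eq_sym cn0.
have xi0 : 0 < xi by rewrite subr_gt0.
pose k := Num.min kappa (2 * xi / theta).
have k0 : 0 < k by rewrite lt_min kappa_gt0 divr_gt0 ?mulr_gt0.
have [T1 [_ potT1]] : \forall t \near +oo, c / 2 <= pot t.
  by apply: (cvgr_ge c pc); rewrite ltr_pdivrMr// ltr_pMr// ltr1n.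
pose s := Num.max T T1 + 1.
have Ts : T < s by rewrite /s ltr_pwDr// le_max lexx.
have T1s : T1 < s by rewrite /s ltr_pwDr// le_max lexx orbT.
have decr t : s <= t -> energy xs ls t + k * c / 2 * ln t
    <= energy xs ls s + k * c / 2 * ln s.
  move=> st; have Ed u (Tu : T < u) := energy_derive ls Axs Tu.
  apply: (@nonincreasing_of_derive_le0 R
    (fun u => energy xs ls u + k * c / 2 * ln u) _ T) st _ => // [u Tu|u su].
    have Edu := Ed u Tu; have lnu := is_derive1_ln (lt_trans T_gt0 Tu).
    by derive_arith.
  have Tu := lt_le_trans Ts su; have u0 := lt_trans T_gt0 Tu.
  have := energy_derive_ub ls Axs Tu.
  have pu := potT1 u (lt_le_trans T1s su).
  have th0 := ltW theta_gt0; have d0 := ltW (delta_gt0 Tu).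
  have kr : 0 <= ratio u - k by rewrite subr_ge0 ge_min ratio_ge.
  have kx : 0 <= xi - k * theta / 2.
    by rewrite subr_ge0 ler_pdivrMr// -ler_pdivlMr// ge_min (mulrC xi) lexx orbT.
  have g0 := saddle_gap_ge0 (x u) sol.
  have sp0 : 0 <= speed2 u by rewrite addr_ge0 ?dot_ge0.
  have h1 : 0 <= theta ^+ 2 * u * delta u * gap xs ls (x u) * (ratio u - k).
    by rewrite !mulr_ge0// ltW.
  have h2 : 0 <= theta * u * speed2 u * (xi - k * theta / 2).
    by rewrite !mulr_ge0// ltW.
  have h3 : k * (c / 2) / u <= k * (pot u) / u.
    apply: ler_wpM2r; first by rewrite invr_ge0 ltW.
    by apply: ler_wpM2l => //; exact: ltW.
  have potE : k * pot u / u = k * theta ^+ 2 * u * (delta u * gap xs ls (x u)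
      + speed2 u / 2) by rewrite /pot; field; rewrite gt_eqF.
  rewrite potE in h3.
  lra.
have [t [st lt_ln]] : exists t, s <= t /\
    energy xs ls s + k * c / 2 * ln s < k * c / 2 * ln t.
  have kc0 : 0 < k * c / 2 by rewrite divr_gt0// mulr_gt0.
  have lnoo := [elaborate gt0_cvgMry kc0 (@ln_cvgy R)].
  have lnbig : \forall t \near +oo,
      energy xs ls s + k * c / 2 * ln s < k * c / 2 * ln t.
    by move/cvgryPgt : lnoo; apply.
  by have [t H] := filter_ex (filterI (nbhs_pinfty_ge (num_real s)) lnbig); exists t.
have := decr t st; have := energy_ge0 (lt_le_trans Ts st).
lra.
Qed.

Let weighted_gap_cvg0 : t ^+ 2 * delta t * gap xs ls (x t) @[t --> +oo] --> 0.
Proof.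
have p0 : theta ^- 2 * pot t @[t --> +oo] --> 0.
  by rewrite -(mulr0 (theta ^- 2)); apply: cvgM (cvg_cst _) pot_cvg0.
apply: squeeze_cvgr (cvg_cst 0) p0.
apply: after_T => t Tt; have d0 := ltW (delta_gt0 Tt).
have t0 := ltW (lt_trans T_gt0 Tt); have g0 := saddle_gap_ge0 (x t) sol.
have s0 : 0 <= t ^+ 2 * speed2 t.
  by rewrite mulr_ge0 ?sqr_ge0// addr_ge0 ?dot_ge0.
rewrite !mulr_ge0//= /pot mulrA mulVf ?sqrf_eq0 ?gt_eqF// mul1r lerDl.
by rewrite divr_ge0.
Qed.

Lemma speed_cvg0 :
  t ^+ 2 * (dot (x' t) (x' t) + dot (l' t) (l' t)) @[t --> +oo] --> 0.
Proof.
have p0 : 2 * theta ^- 2 * pot t @[t --> +oo] --> 0.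
  by rewrite -(mulr0 (2 * theta ^- 2)); apply: cvgM (cvg_cst _) pot_cvg0.
apply: squeeze_cvgr (cvg_cst 0) p0.
apply: after_T => t Tt; rewrite -/(speed2 t); have d0 := ltW (delta_gt0 Tt).
have t0 := ltW (lt_trans T_gt0 Tt); have g0 := saddle_gap_ge0 (x t) sol.
have s0 : 0 <= speed2 t by rewrite addr_ge0 ?dot_ge0.
have w0 : 0 <= t ^+ 2 * delta t * gap xs ls (x t) by rewrite !mulr_ge0.
rewrite mulr_ge0 ?sqr_ge0//= /pot -mulrA (mulrA (theta ^- 2)).
by rewrite mulVf ?sqrf_eq0 ?gt_eqF// mul1r; lra.
Qed.

Let l'_coord_cvg0 j : t * l' t j ord0 @[t --> +oo] --> 0.
Proof.
apply/cvgr0Pnorm_le => e e0.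
have : \forall t \near +oo,
    `|t ^+ 2 * (dot (x' t) (x' t) + dot (l' t) (l' t))| <= e ^+ 2.
  by move/cvgr0Pnorm_le : speed_cvg0; apply; rewrite exprn_gt0.
apply: filterS => t /(le_trans (ler_norm _)) H.
rewrite -(ler_pXn2r (n := 2)) ?nnegrE ?(ltW e0)// real_normK ?num_real//.
apply: le_trans H; rewrite exprMn ler_wpM2l ?sqr_ge0//.
by apply: le_trans (sqr_coord_le _ _) _; rewrite lerDr dot_ge0.
Qed.

Let Lrate_cvgy : Lrate t @[t --> +oo] --> +oo.
Proof.
pose s := T + 1; have Ts : T < s by rewrite ltrDl.
have kln := [elaborate gt0_cvgMry kappa_gt0 (@ln_cvgy R)].
apply/cvgryPge => M; move/cvgryPge : kln => /(_ (M - (Lrate s - kappa * ln s))).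
apply: filterS2 (nbhs_pinfty_ge (num_real s)) => t st Mt.
have := @nonincreasing_of_derive_le0 R (fun u => kappa * ln u - Lrate u)
  (fun u => kappa * u^-1 - rate u) T _ s t Ts st.
have H1 u : T < u -> is_derive u 1 (fun u => kappa * ln u - Lrate u)
    (kappa * u^-1 - rate u).
  move=> Tu; have Ld := Lrate_derive Tu.
  by have lnu := is_derive1_ln (lt_trans T_gt0 Tu); derive_by ring.
have H2 u : s <= u -> kappa * u^-1 - rate u <= 0.
  move=> su; have Tu := lt_le_trans Ts su; rewrite subr_le0 /rate.
  by rewrite ler_wpM2r ?ratio_ge// invr_ge0 ltW// (lt_trans T_gt0).
by move=> /(_ H1 H2); lra.
Qed.

(** Both [r j] and its relaxation [h j] converge to [(alpha - 1) * ls j], and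
    [g j] is their difference. *)
Lemma weighted_residual_cvg0 j :
  t ^+ 2 * delta t * (A *m x t - b) j ord0 @[t --> +oo] --> 0.
Proof.
have rc : r j t @[t --> +oo] --> (alpha - 1) * ls j ord0.
  have lj : l t j ord0 @[t --> +oo] --> ls j ord0 by move/cvg_mxP : l_cvg.
  have := [elaborate cvgD (@l'_coord_cvg0 j) (cvgM (cvg_cst (alpha - 1)) lj)].
  by rewrite add0r; apply.
have hc := relaxation_cvg Lrate_derive rate_ge0 (residual_relaxation j) Lrate_cvgy rc.
have := [elaborate cvgM (cvg_cst theta^-1) (cvgB rc hc)].
rewrite subrr mulr0; apply: cvg_trans; apply: near_eq_cvg.
apply: after_T => t Tt /=; rewrite /h subKr /g /res.
by rewrite -!mulrA mulKf// gt_eqF.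
Qed.

Lemma weighted_objective_cvg0 :
  t ^+ 2 * delta t * (f (x t) - f xs) @[t --> +oo] --> 0.
Proof.
have wr0 : (t ^+ 2 * delta t) *: res t @[t --> +oo] --> (0 : 'cV[R]_m).
  apply/cvg_mxP => j k; rewrite ord1 mxE.
  rewrite (_ : (fun t => _) = fun t => t ^+ 2 * delta t * res t j ord0).
    exact: weighted_residual_cvg0.
  by apply/funext => t; rewrite mxE.
have lr0 := [elaborate cvg_dot (cvg_cst ls) wr0].
have rr0 := [elaborate cvg_dot residual_cvg0 wr0].
rewrite !dot0r in lr0 rr0.
have := [elaborate cvgB (cvgB weighted_gap_cvg0 lr0) (cvgM (cvg_cst (beta / 2)) rr0)].
rewrite mulr0 !subr0; apply: cvg_trans; apply: near_eq_cvg; apply: nearW => t /=.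
by rewrite !fctE /= /gap -/(res t) !dotZr; lra.
Qed.

End strict_rates.

End saddle_point.

(** ** Uniqueness of the cluster point *)

(** The gap does not see the component of the multiplier in the kernel of
    [A^T], since [A *m y - b] lies in the range of [A]. *)
Lemma gap_eq p1 q1 p2 q2 y : primal_dual_solutions f A b (p1, q1) ->
  primal_dual_solutions f A b (p2, q2) -> A^T *m q1 = A^T *m q2 ->
  gap p1 q1 y = gap p2 q2 y.
Proof.
move=> sol1 sol2 q12; have [/= A1 _] := sol1; have [/= A2 _] := sol2.
have := saddle_lagrangian_ge0 p2 sol1; have := saddle_lagrangian_ge0 p1 sol2.
rewrite A1 A2 subrr !dot0r /gap => h1 h2.
have -> : dot q1 (A *m y - b) = dot q2 (A *m y - b).
  by rewrite -A1 -mulmxBr -!dot_trmx q12.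
lra.
Qed.

(** The difference of the two energies converges, and it equals
    [(1 + xi) * H + theta * t * H' + C], where [H] is the product of the
    trajectory with the difference of the two solutions; hence [H] converges. *)
Lemma scalar_product_cvg p1 q1 p2 q2 : primal_dual_solutions f A b (p1, q1) ->
  primal_dual_solutions f A b (p2, q2) -> A^T *m q1 = A^T *m q2 ->
  exists c : R,
    dot (x t) (p2 - p1) + dot (l t) (q2 - q1) @[t --> +oo] --> c.
Proof.
move=> sol1 sol2 q12.
have [c1 E1] := energy_cvg sol1; have [c2 E2] := energy_cvg sol2.
have xi1 : 0 < 1 + xi by rewrite ltr_pwDl.
pose H t := dot (x t) (p2 - p1) + dot (l t) (q2 - q1).
pose H' t := dot (x' t) (p2 - p1) + dot (l' t) (q2 - q1).
pose C := (1 + xi) / 2 * (dot p1 p1 - dot p2 p2 + (dot q1 q1 - dot q2 q2)).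
have Hd t : T < t -> is_derive t 1 H (H' t).
  move=> Tt; have xd := is_derive_dot (x_derive Tt) (is_derive_cst (p2 - p1) t 1).
  have ld := is_derive_dot (l_derive Tt) (is_derive_cst (q2 - q1) t 1).
  by rewrite /H; derive_by (rewrite !dot0r /H'; ring).
have HE t : H t + theta / (1 + xi) * t * H' t =
    (1 + xi)^-1 * (energy p1 q1 t - energy p2 q2 t - C).
  rewrite /energy (gap_eq (x t) sol1 sol2 q12) /vx /vl /dist2 /H /H' /C.
  rewrite !dotDE !(dotC p1 (x t)) !(dotC p2 (x t)) !(dotC q1 (l t)).
  rewrite !(dotC q2 (l t)) !(dotC p1 (x' t)) !(dotC p2 (x' t)).
  rewrite !(dotC q1 (l' t)) !(dotC q2 (l' t)).
  by field; rewrite gt_eqF.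
exists ((1 + xi)^-1 * (c1 - c2 - C)).
apply: (euler_cvg (ltW T_gt0) (divr_gt0 theta_gt0 xi1) Hd).
rewrite (_ : (fun t => _) = fun t =>
    (1 + xi)^-1 * (energy p1 q1 t - energy p2 q2 t - C)); last exact/funext.
by apply: cvgM (cvg_cst _) _; apply: cvgB (cvg_cst C); exact: cvgB.
Qed.

Let pair_cluster p q : cluster ((x t, l t) @[t --> +oo]) (p, q) ->
  cluster (x t @[t --> +oo]) p /\ cluster (l t @[t --> +oo]) q.
Proof.
move=> zpq; split=> S W SF Wp.
  have Wpq : nbhs (p, q) [set z | W z.1].
    by exists (W, setT) => //=; [split=> //; exact: filterT|move=> z []].
  by have [[p' q'] [/= Sp' Wp']] := zpq [set z | S z.1] _ SF Wpq; exists p'.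
have Wpq : nbhs (p, q) [set z | W z.2].
  by exists (setT, W) => //=; [split=> //; exact: filterT|move=> z []].
by have [[p' q'] [/= Sq' Wq']] := zpq [set z | S z.2] _ SF Wpq; exists q'.
Qed.

Lemma trajectory_cvg xs ls : primal_dual_solutions f A b (xs, ls) ->
  exists z, primal_dual_solutions f A b z /\ (x t, l t) @[t --> +oo] --> z.
Proof.
move=> sol.
have cluster_sol p q : cluster ((x t, l t) @[t --> +oo]) (p, q) ->
    primal_dual_solutions f A b (p, q) /\ A^T *m q = A^T *m ls.
  move=> /pair_cluster[/(x_cluster sol)[Ap gp] /(dual_cluster sol) qE].
  by split=> //; split=> //=; rewrite gp qE addNr.
have cluster_eq z1 z2 : cluster ((x t, l t) @[t --> +oo]) z1 ->
    cluster ((x t, l t) @[t --> +oo]) z2 -> z2 = z1.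
  case: z1 z2 => [p1 q1] [p2 q2] c1 c2.
  have [sol1 q1E] := cluster_sol _ _ c1; have [sol2 q2E] := cluster_sol _ _ c2.
  have [c Hc] := scalar_product_cvg sol1 sol2 (etrans q1E (esym q2E)).
  pose H (z : 'cV[R]_n * 'cV[R]_m) := dot z.1 (p2 - p1) + dot z.2 (q2 - q1).
  have cH z : {for z, continuous H}.
    have z1 := [elaborate cvg_dot (@cvg_fst _ _ (nbhs z.1) (nbhs z.2) _)
      (cvg_cst (p2 - p1))].
    have z2 := [elaborate cvg_dot (@cvg_snd _ _ (nbhs z.1) (nbhs z.2) _)
      (cvg_cst (q2 - q1))].
    exact: [elaborate cvgD z1 z2].
  have H1 : H (p1, q1) = c by exact: cluster_cvg_eq (@Rhausdorff R) c1 (cH _) Hc.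
  have H2 : H (p2, q2) = c by exact: cluster_cvg_eq (@Rhausdorff R) c2 (cH _) Hc.
  have : dot (p2 - p1) (p2 - p1) + dot (q2 - q1) (q2 - q1) = 0.
    have -> : dot (p2 - p1) (p2 - p1) + dot (q2 - q1) (q2 - q1) =
        H (p2, q2) - H (p1, q1) by rewrite /H/= !(dotDl, dotNl); ring.
    by rewrite H1 H2 subrr.
  move/eqP; rewrite paddr_eq0 ?dot_ge0// => /andP[/eqP/dot_eq0 + /eqP/dot_eq0].
  by move=> /eqP; rewrite subr_eq0 => /eqP -> /eqP; rewrite subr_eq0 => /eqP ->.
have [M xM] := eventually_bounded_uniform (x_bounded sol).
have [N lN] := eventually_bounded_uniform (l_bounded sol).
have cK := compact_setX (@compact_box R n M) (@compact_box R m N).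
have zK := [elaborate filterI xM lN].
have [[p q] [_ zpq]] := cK _ (fmap_proper_filter (fun t => (x t, l t)) _) zK.
exists (p, q); split; first by have [] := cluster_sol _ _ zpq.
apply: (@cvg_of_cluster _ _ ((x t, l t) @[t --> +oo]) _ _ id (p, q) cK zK) => //.
  by move=> z; exact: cvg_id.
by move=> z; exact: cluster_eq _ _ zpq.
Qed.

End lyapunov.

(** * From the dynamical system to the theorem *)

Section weighted_norms.
Variable R : realType.

Lemma littleo_weight (u w : R -> R) : (\forall t \near +oo, 0 < w t) ->
  w t * u t @[t --> +oo] --> 0 ->
  u =o_ (pinfty_nbhs R) (fun t => (w t)^-1).
Proof.
move=> w_gt0 wu0; apply/eqoP => e e0.
have wue : \forall t \near +oo, `|w t * u t| <= e by move/cvgr0Pnorm_le : wu0; apply.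
apply: filterS2 w_gt0 wue => t wt; rewrite normrM gtr0_norm// => h.
have wV : 0 < (w t)^-1 by rewrite invr_gt0.
by rewrite (gtr0_norm wV) ler_pdivlMr// mulrC.
Qed.

Lemma enorm_weight_cvg0 n (u : R -> 'cV[R]_n) (w : R -> R) :
  (\forall t \near +oo, 0 < w t) ->
  w t ^+ 2 * dot (u t) (u t) @[t --> +oo] --> 0 ->
  w t * enorm (u t) @[t --> +oo] --> 0.
Proof.
move=> w_gt0 wu0.
have s0 : Num.sqrt (w t ^+ 2 * dot (u t) (u t)) @[t --> +oo] --> 0.
  by rewrite -(sqrtr0 R); apply: continuous_cvg wu0; exact: sqrt_continuous.
apply: cvg_trans s0; apply: near_eq_cvg; apply: filterS w_gt0 => t wt.
by rewrite enorm_dot sqrtrM ?sqr_ge0// sqrtr_sqr gtr0_norm.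
Qed.

Lemma dot_col_mx n m (u1 v1 : 'cV[R]_n) (u2 v2 : 'cV[R]_m) :
  dot (col_mx u1 u2) (col_mx v1 v2) = dot u1 v1 + dot u2 v2.
Proof. by rewrite /dot tr_col_mx mul_row_col mxE. Qed.

Lemma interior_ray (t0 t : R) : t0 < t -> (`[t0, +oo[%classic)° t.
Proof.
move=> t0t; near=> s; rewrite /= in_itv/= andbT ltW//.
by near: s; exact: lt_nbhsr.
Unshelve. all: by end_near. Qed.

End weighted_norms.

Section log_slopes.
Variables (R : realType) (t0 : R) (delta : R -> R).
Let slope t := t * derive_within `[t0, +oo[%classic delta t / delta t.

Let slope_in t : t0 <= t -> log_slopes t0 delta (slope t)%:E.
Proof. by move=> t0t; exists t => //=; rewrite in_itv/= t0t. Qed.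

Lemma log_slopes_lb : (-oo < ereal_inf (log_slopes t0 delta))%E ->
  exists K, forall t, t0 <= t -> K <= slope t.
Proof.
move=> infN; have inf_le t : t0 <= t ->
    (ereal_inf (log_slopes t0 delta) <= (slope t)%:E)%E.
  by move=> /slope_in; exact: ereal_inf_lbound.
have inf_fin : ereal_inf (log_slopes t0 delta) \is a fin_num.
  by rewrite fin_numElt infN (le_lt_trans (inf_le t0 _))// ltry.
exists (fine (ereal_inf (log_slopes t0 delta))) => t t0t.
by rewrite -lee_fin fineK// inf_le.
Qed.

Lemma log_slopes_ub M : (ereal_sup (log_slopes t0 delta) <= M%:E)%E ->
  forall t, t0 <= t -> slope t <= M.
Proof.
move=> supM t t0t; rewrite -lee_fin; apply: le_trans supM.
exact/ereal_sup_ubound/slope_in.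
Qed.

Lemma log_slopes_lt M : (ereal_sup (log_slopes t0 delta) < M%:E)%E ->
  exists2 kappa, 0 < kappa & forall t, t0 <= t -> slope t <= M - kappa.
Proof.
move=> supM; have sup_ge t : t0 <= t ->
    ((slope t)%:E <= ereal_sup (log_slopes t0 delta))%E.
  by move=> /slope_in; exact: ereal_sup_ubound.
have sup_fin : ereal_sup (log_slopes t0 delta) \is a fin_num.
  by rewrite fin_numElt (lt_le_trans _ (sup_ge t0 _)) ?ltNyr// (lt_trans supM) ?ltry.
exists (M - fine (ereal_sup (log_slopes t0 delta))).
  by rewrite subr_gt0 -lte_fin fineK.
by move=> t t0t; rewrite subKr -lee_fin fineK// sup_ge.
Qed.

End log_slopes.

(** Moving along the kernel of [A] keeps a minimizer feasible, so the gradient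
    there is orthogonal to that kernel. *)
Lemma primal_dual_nonempty (R : realType) n m (f : 'cV[R]_n -> R)
    (A : 'M[R]_(m, n)) b : (forall y, differentiable f y) ->
  primal_solutions f A b !=set0 ->
  exists xs ls, primal_dual_solutions f A b (xs, ls).
Proof.
move=> f_diff [xs [Axs xs_min]].
have [|ls lsE] := @orthogonal_kernel R n m A (grad f xs); last by exists xs, ls.
move=> d Ad; apply: (grad_of_support f_diff) => h; rewrite mulr0 addr0.
by apply: xs_min; rewrite mulmxDr -scalemxAr Ad scaler0 addr0.
Qed.

Theorem theorem4p2 (R : realType) (n m : nat) (f : 'cV[R]_n -> R)
    (A : 'M[R]_(m, n)) (b : 'cV[R]_m)
    (t0 alpha theta beta delta0 : R) (delta : R -> R)
    (x : R -> 'cV[R]_n) (lam : R -> 'cV[R]_m)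
    (f_convex : convex_function [set: convex_lmodType 'cV[R]_n] f)
    (f_C1 : continuously_differentiable f)
    (S_nonempty : primal_solutions f A b !=set0)
    (t0_gt0 : 0 < t0)
    (alpha_ge3 : 3 <= alpha)
    (theta_bounds : (alpha - 1)^-1 <= theta <= 2^-1)
    (beta_ge0 : 0 <= beta)
    (delta0_gt0 : 0 < delta0)
    (delta_ge : forall t, t0 <= t -> delta0 <= delta t)
    (delta_C1 : C1_on `[t0, +oo[%classic delta)
    (delta_inf : (-oo < ereal_inf (log_slopes t0 delta))%E)
    (delta_sup : (ereal_sup (log_slopes t0 delta) <= (theta^-1 - 2)%:E)%E)
    (delta_lim : t ^+ 2 * delta t @[t --> +oo] --> +oo)
    (trajectory : global_trajectory f A b t0 alpha theta beta delta x lam) :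
  exists xs : 'cV[R]_n, exists ls : 'cV[R]_m,
    [/\ primal_dual_solutions f A b (xs, ls),
        (x t, lam t) @[t --> +oo] --> (xs, ls)
      & 3 < alpha ->
        (alpha - 1)^-1 < theta < 2^-1 ->
        (ereal_sup (log_slopes t0 delta) < (theta^-1 - 2)%:E)%E ->
        [/\ (fun t => enorm (col_mx (derive_within `[t0, +oo[%classic x t)
                                    (derive_within `[t0, +oo[%classic lam t)))
              =o_ (pinfty_nbhs R) (fun t => t^-1),
            (fun t => enorm (A *m x t - b))
              =o_ (pinfty_nbhs R) (fun t => (t ^+ 2 * delta t)^-1)
          & (fun t => `|f (x t) - f xs|)
              =o_ (pinfty_nbhs R) (fun t => (t ^+ 2 * delta t)^-1)]].
Proof.
have [f_diff grad_cont] := f_C1.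
have [tw_x tw_l x_eq l_eq] := trajectory.
set D := `[t0, +oo[%classic in x_eq l_eq tw_x tw_l *.
pose x' := derive_within D x; pose l' := derive_within D lam.
have inD t : t0 <= t -> D t by move=> t0t; rewrite /D/= in_itv/= t0t.
have der (V : normedModType R) (g : R -> V) : differentiable_on D g ->
    forall t, t0 < t -> is_derive t 1 g (derive_within D g t).
  move=> gD t t0t; apply: derive_within_interior; first exact: interior_ray.
  exact/gD/inD/ltW.
have a1 : 0 < alpha - 1 by lra.
have [/andP[th1 th2]] := (theta_bounds, tt).
have th0 : 0 < theta by apply: lt_le_trans th1; rewrite invr_gt0.
have ath : 1 <= theta * (alpha - 1) by rewrite -ler_pdivrMr// div1r.
have d0 t : t0 < t -> 0 < delta t.
  by move=> /ltW /delta_ge; exact: lt_le_trans.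
have dd := der _ delta (proj1 delta_C1).
have [K slopeK] := log_slopes_lb delta_inf.
have slope_ub := log_slopes_ub delta_sup.
have [xs0 [ls0 sol0]] := primal_dual_nonempty f_diff S_nonempty.
have x_d := der _ x (proj1 tw_x); have x'_d := der _ x' (proj2 tw_x).
have l_d := der _ lam (proj1 tw_l); have l'_d := der _ l' (proj2 tw_l).
have gtP (P : R -> Prop) : (forall t, t0 <= t -> P t) -> forall t, t0 < t -> P t.
  by move=> H t /ltW; exact: H.
have x_eq' := gtP _ (fun t p => x_eq t (inD t p)).
have l_eq' := gtP _ (fun t p => l_eq t (inD t p)).
have [[xs ls] [sol z_cvg]] := trajectory_cvg f_diff grad_cont f_convex t0_gt0 th0
  ath beta_ge0 d0 dd delta_lim (gtP _ slopeK) (gtP _ slope_ub)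
  x_d x'_d l_d l'_d x_eq' l_eq' sol0.
exists xs, ls; split=> // a3 /andP[th1' _] sup_lt.
have xc : x t @[t --> +oo] --> xs by exact: (cvg_comp _ _ z_cvg cvg_fst).
have lc : lam t @[t --> +oo] --> ls by exact: (cvg_comp _ _ z_cvg cvg_snd).
have ath' : 1 < theta * (alpha - 1) by rewrite -ltr_pdivrMr// div1r.
have [kappa k0 slope_k] := log_slopes_lt sup_lt.
have ratio_ge t : t0 < t ->
    kappa <= theta^-1 - 2 - t * derive_within D delta t / delta t.
  by move=> /ltW /slope_k; lra.
have w0 : \forall t \near +oo, 0 < t ^+ 2 * delta t.
  exists t0; split=> [|t t0t]; first exact: num_real.
  by rewrite mulr_gt0 ?d0// exprn_gt0// (lt_trans t0_gt0).
have speed0 := speed_cvg0 f_diff f_convex t0_gt0 th0 ath beta_ge0 d0 dd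
  (gtP _ slope_ub) x_d x'_d l_d l'_d x_eq' l_eq' sol xc lc ath' k0 ratio_ge.
have res0 := weighted_residual_cvg0 f_diff f_convex t0_gt0 th0 ath beta_ge0 d0 dd
  (gtP _ slope_ub) x_d x'_d l_d l'_d x_eq' l_eq' sol xc lc ath' k0 ratio_ge.
have obj0 := weighted_objective_cvg0 f_diff f_convex t0_gt0 th0 ath beta_ge0 d0 dd
  delta_lim (gtP _ slope_ub) x_d x'_d l_d l'_d x_eq' l_eq' sol xc lc ath' k0 ratio_ge.
split.
- apply: (@littleo_weight R _ id).
    by exists 0; split=> //; exact: num_real.
  apply: enorm_weight_cvg0; first by exists 0; split=> //; exact: num_real.
  rewrite (_ : (fun t => _) =
    fun t => t ^+ 2 * (dot (x' t) (x' t) + dot (l' t) (l' t)))//.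
  by apply/funext => t; rewrite dot_col_mx.
- apply: littleo_weight => //; apply: enorm_weight_cvg0 => //.
  have wr0 : (t ^+ 2 * delta t) *: (A *m x t - b) @[t --> +oo] --> (0 : 'cV[R]_m).
    apply/cvg_mxP => j k; rewrite ord1 mxE.
    rewrite (_ : (fun t => _) = fun t => t ^+ 2 * delta t * (A *m x t - b) j ord0).
      exact: res0.
    by apply/funext => t; rewrite mxE.
  have := [elaborate cvg_dot wr0 wr0]; rewrite dot0r.
  rewrite (_ : (fun t => dot _ _) = fun t => (t ^+ 2 * delta t) ^+ 2
    * dot (A *m x t - b) (A *m x t - b))//.
  by apply/funext => t; rewrite dotZl dotZr mulrA -expr2.
- apply: littleo_weight => //; apply/cvgr0Pnorm_le => e e0.
  move/cvgr0Pnorm_le : obj0 => /(_ e e0); apply: filterS => t.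
  by rewrite !normrM normr_id.
Qed.
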